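(* Let $K\geq2$, $P>0$ and $\sigma_1^2\geq\sigma_2^2\geq\cdots\geq\sigma_K^2>0$, and for $k\in\{1,\ldots,K\}$ let $N_k=\left(\sum_{k'=1}^{k}\frac{1}{\sigma_{k'}^2}\right)^{-1}$. Then \[ C^{(\mathrm{Lin})}\leq \frac12\log\left(1+\frac{\alpha_1^\star P}{(1-\alpha_1^\star)P+\sigma_1^2}\right), \] where $\alpha_1^\star$ lies in the open interval $(0,1)$ and is such that there exist $\alpha_2^\star,\ldots,\alpha_K^\star\in(0,1)$ with $\alpha_1^\star+\alpha_2^\star+\cdots+\alpha_K^\star=1$ and, for every $k\in\{2,\ldots,K\}$, \[ \frac12\log\left(1+\frac{\alpha_k^\star P}{(1-\alpha_1^\star-\cdots-\alpha_k^\star)P+N_k}\right)=\frac12\log\left(1+\frac{\alpha_1^\star P}{(1-\alpha_1^\star)P+\sigma_1^2}\right). \]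
   Context: Channel: for blocklength $n$, at time $i$ the transmitter sends $X_i\in\mathbb{R}$ and Receiver $k\in\{1,\ldots,K\}$ observes $Y_{k,i}=X_i+Z_{k,i}$, where the vectors $(Z_{1,i},\ldots,Z_{K,i})$ are i.i.d. over $i$, centered Gaussian with covariance $\mathrm{diag}(\sigma_1^2,\ldots,\sigma_K^2)$. A common message $M$ uniform on $\{1,\ldots,\lfloor e^{nR}\rfloor\}$, independent of the noises, is to be decoded by all receivers. Perfect feedback: inputs $X_i=f_i(M,Y_1^{i-1},\ldots,Y_K^{i-1})$, subject to $\frac1n\mathbb{E}[\sum_{i=1}^nX_i^2]\leq P$. Receiver $k$ decodes $\hat M^{(k)}=g_k(Y_k^n)$; error probability $P_e^{(n)}=\Pr[\bigcup_k\{\hat M^{(k)}\neq M\}]$. Logarithms are natural. A linear-feedback scheme with a message point: the encoder maps $M$ by an arbitrary function to a real number $\Theta$, and each $X_i$ is a linear function of $(\Theta,Y_1^{i-1},\ldots,Y_K^{i-1})$; decoders are arbitrary. A rate $R>0$ is achievable by such schemes if for every $\epsilon>0$ there is a sequence (over $n$) of such schemes satisfying the power constraint with $P_e^{(n)}<\epsilon$ for all sufficiently large $n$; $C^{(\mathrm{Lin})}$ denotes the supremum of such rates. *)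

(* Defs.v *)
From HB Require Import structures.
From mathcomp Require Import all_boot all_order all_algebra.
From mathcomp Require Import all_classical all_reals all_analysis.
Set Implicit Arguments.
Unset Strict Implicit.
Unset Printing Implicit Defensive.
Import Order.TTheory GRing.Theory Num.Theory.
Local Open Scope classical_set_scope.
Local Open Scope ring_scope.

Section Defs.
Variable R : realType.

(* Expectation of a nonnegative functional f of a finite sequence of
   independent centered Gaussians with standard deviations [sds]
   (iterated integrals against the library's [normal_prob 0 s]). *)
Fixpoint gexp (sds : seq R) (f : seq R -> \bar R) : \bar R :=
  match sds with
  | [::] => f [::]
  | s :: sds' => (\int[normal_prob 0 s]_x gexp sds' (fun zs => f (x :: zs)))%E
  end.

(* Noise sample of blocklength n for K receivers is a list z of length n*K;
   Z_{k,i} (receiver k in 1..K, time i in 0..n-1) is its (i*K + k-1)-th entry,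
   with variance s2 k. *)
Definition noise_sds (K n : nat) (s2 : nat -> R) : seq R :=
  [seq Num.sqrt (s2 (j %% K).+1) | j <- iota 0 (n * K)].

Definition Znoise (K : nat) (z : seq R) (k i : nat) : R := nth 0 z (i * K + k.-1).

(* A linear-feedback scheme with a message point, blocklength n, K receivers:
   Theta = theta m ;
   X_i = acoef i * Theta + sum_{j<i} sum_{k=1..K} bcoef i j k * Y_{k,j} ;
   receiver k decodes dec k (Y_k^n). *)
Record lin_scheme (n : nat) := LinScheme {
  theta : nat -> R ;
  acoef : nat -> R ;
  bcoef : nat -> nat -> nat -> R ;
  dec : nat -> n.-tuple R -> nat }.

Fixpoint inputs (K : nat) (a : nat -> R) (b : nat -> nat -> nat -> R)
    (th : R) (z : seq R) (i : nat) : seq R :=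
  match i with
  | 0 => [::]
  | i'.+1 =>
    let xs := inputs K a b th z i' in
    rcons xs (a i' * th +
      \sum_(j < i') \sum_(k < K) b i' j k.+1 * (nth 0 xs j + Znoise K z k.+1 j))
  end.

Definition sch_inputs n K (S : lin_scheme n) (m : nat) (z : seq R) : seq R :=
  inputs K (acoef S) (bcoef S) (theta S m) z n.

Definition sch_output n K (S : lin_scheme n) (m : nat) (z : seq R) (k : nat)
  : n.-tuple R :=
  [tuple nth 0 (sch_inputs K S m z) i + Znoise K z k i | i < n].

Definition dec_measurable n K (S : lin_scheme n) : Prop :=
  forall k, (1 <= k <= K)%N -> forall j : nat, measurable (dec S k @^-1` [set j]).

Definition num_messages (n : nat) (r : R) : nat := Num.truncn (expR (n%:R * r)).

Definition sch_energy n K (s2 : nat -> R) (Mn : nat) (S : lin_scheme n) : \bar R :=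
  ((Mn%:R)^-1%:E * \sum_(m < Mn)
     gexp (noise_sds K n s2)
       (fun z => (\sum_(i < n) (nth 0 (sch_inputs K S m z) i) ^+ 2)%:E))%E.

Definition sch_perr n K (s2 : nat -> R) (Mn : nat) (S : lin_scheme n) : \bar R :=
  ((Mn%:R)^-1%:E * \sum_(m < Mn)
     gexp (noise_sds K n s2)
       (fun z => (if [exists k : 'I_K, dec S k.+1 (sch_output K S m z k.+1) != m]
                  then 1 else 0)%:E))%E.

Definition lin_achievable (K : nat) (s2 : nat -> R) (P : R) (r : R) : Prop :=
  0 < r /\
  forall eps : R, 0 < eps ->
    exists N : nat, forall n : nat, (N <= n)%N ->
      exists S : lin_scheme n,
        [/\ dec_measurable K S,
            (sch_energy K s2 (num_messages n r) S <= (n%:R * P)%:E)%E &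
            (sch_perr K s2 (num_messages n r) S < eps%:E)%E].

Definition C_Lin (K : nat) (s2 : nat -> R) (P : R) : \bar R :=
  ereal_sup [set r%:E | r in lin_achievable K s2 P].

Definition Nk (s2 : nat -> R) (k : nat) : R :=
  (\sum_(1 <= k' < k.+1) (s2 k')^-1)^-1.

Definition rate1 (s2 : nat -> R) (P : R) (alpha : nat -> R) : R :=
  2^-1 * ln (1 + alpha 1%N * P / ((1 - alpha 1%N) * P + s2 1%N)).

Definition alpha_star (K : nat) (s2 : nat -> R) (P : R) (alpha : nat -> R) : Prop :=
  [/\ forall k, (1 <= k <= K)%N -> 0 < alpha k < 1,
      \sum_(1 <= k < K.+1) alpha k = 1 &
      forall k, (2 <= k <= K)%N ->
        2^-1 * ln (1 + alpha k * P /
                      ((1 - \sum_(1 <= k' < k.+1) alpha k') * P + Nk s2 k))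
        = rate1 s2 P alpha].

End Defs.

(* Main.v *)
Require Import Defs.
From HB Require Import structures.
From mathcomp Require Import all_boot all_order all_algebra.
From mathcomp Require Import all_classical all_reals all_analysis.
From mathcomp Require Import measurable_realfun.
From mathcomp Require Import zify ring lra.
Set Implicit Arguments.
Unset Strict Implicit.
Unset Printing Implicit Defensive.
Import Order.TTheory GRing.Theory Num.Theory.
Local Open Scope ring_scope.

(* Let a scheme have M messages, and set the message point to 0.  Shifting the
   noises by a dual vector w of the outputs of receiver k imitates the influence
   of the message point, so by comparing shifted Gaussians reliable decoding needs
   M <= C (sqrt v |w| + 1), v being the mean square of the message point.  Taking
   w in the dual basis, for every k some output of receiver k has residual
   variance at most C n^2 / M^2 given its other outputs.  Expand the entropy (log
   Gram determinant) of the outputs of receivers 1..k causally, and compare with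
   the expansion in which that output comes last.  With V_{k,i} the variance of
   X_i given the past outputs of receivers 1..k, this gives
     sum_i log (N_k + V_{k,i}) + 2 log M
       <= sum_i log (N_k + V_{k-1,i}) + O(log n),
   which are the inequalities for private messages of equal rate over the degraded
   Gaussian broadcast channel with noises N_1 >= ... >= N_K; Jensen's inequality
   then yields the common-rate point defined by alpha. *)

(** * Orthogonal residuals and Gram determinants *)

(** The message point enters the outputs only through their means, so covariances computed at
    message point 0 serve for all messages. Its law is arbitrary and not Gaussian; only its mean
    square is ever used, and this is why the comparison of shifted Gaussians stands in for an
    entropy of the outputs.

    The obstacle is that the message is common: once receiver 1 has decoded it, receiver 2 brings no
    further information about it, and an expansion of mutual information would credit [log M] only
    once. The determinant of the noise responses behaves differently. Receiver k must decode from
    its own outputs, so these are nearly linearly dependent at message point 0, whatever the other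
    receivers do; each receiver thus earns its own term [2 log M].

    The noise [N_k] appears because, given the past, the outputs of receivers 1 to k at one time are
    worth one observation of [X_i] with that noise. Polynomial factors in n are given away freely,
    since they vanish from the rate, and a fixed error probability of 1/4 is enough for the
    contradiction. *)

Section InnerProduct.
Variables (F : realFieldType) (V : lmodType F) (dot : V -> V -> F).
Hypothesis dotC : forall x y, dot x y = dot y x.
Hypothesis dotDl : forall x y z, dot (x + y) z = dot x z + dot y z.
Hypothesis dotZl : forall c x z, dot (c *: x) z = c * dot x z.
Hypothesis dot_ge0 : forall x, 0 <= dot x x.
Hypothesis dot_eq0 : forall x, dot x x = 0 -> x = 0.

Lemma dotDr x y z : dot x (y + z) = dot x y + dot x z.
Proof. by rewrite dotC dotDl !(dotC x). Qed.

Lemma dotZr c x z : dot x (c *: z) = c * dot x z.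
Proof. by rewrite dotC dotZl (dotC x). Qed.

Lemma dotNl x z : dot (- x) z = - dot x z.
Proof. by rewrite -scaleN1r dotZl mulN1r. Qed.

Lemma dotNr x z : dot x (- z) = - dot x z.
Proof. by rewrite dotC dotNl dotC. Qed.

Lemma dot0l z : dot 0 z = 0.
Proof. by rewrite -(scale0r 0) dotZl mul0r. Qed.

Lemma dot0r z : dot z 0 = 0.
Proof. by rewrite dotC dot0l. Qed.

Lemma dot_suml I (r : seq I) (P : pred I) (f : I -> V) z :
  dot (\sum_(i <- r | P i) f i) z = \sum_(i <- r | P i) dot (f i) z.
Proof.
by elim/big_rec2: _ => [|i y1 y2 _ <-]; rewrite ?dot0l// dotDl.
Qed.

Lemma dot_sumr I (r : seq I) (P : pred I) (f : I -> V) z :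
  dot z (\sum_(i <- r | P i) f i) = \sum_(i <- r | P i) dot z (f i).
Proof. by rewrite dotC dot_suml; apply: eq_bigr => i _; rewrite dotC. Qed.

Let dotE := (dotDl, dotDr, dotZl, dotZr, dotNl, dotNr).

(** Twice an inner product is at most the sum of the two squared norms; this is summed over all
    pairs of indices. *)
Lemma dot_sum_le (n : nat) (f : 'I_n -> V) :
  dot (\sum_i f i) (\sum_i f i) <= n%:R * \sum_i dot (f i) (f i).
Proof.
rewrite dot_suml.
have -> : n%:R * (\sum_i dot (f i) (f i)) =
    \sum_i \sum_j (2^-1 * (dot (f i) (f i) + dot (f j) (f j))).
  under [RHS]eq_bigr do rewrite -mulr_sumr big_split/= sumr_const card_ord.
  rewrite -mulr_sumr big_split/= sumr_const card_ord sumrMnl -mulr_natl.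
  set S := \sum_(i < n) _; rewrite mulr1 -(mulr_natl S n) -mulr2n.
  by rewrite -(mulr_natl (_ * S)) mulKf ?pnatr_eq0.
apply: ler_sum => i _; rewrite dot_sumr; apply: ler_sum => j _.
have := dot_ge0 (f i - f j); rewrite !dotE (dotC (f j)).
lra.
Qed.

(* Gram-Schmidt residual: the component of [x] orthogonal to the span of [G]. *)
Fixpoint res (G : seq V) (x : V) : V :=
  if G is g :: G' then
    let b := res G' g in
    res G' x - (dot (res G' x) b / dot b b) *: b
  else x.

Lemma resD G x y : res G (x + y) = res G x + res G y.
Proof.
elim: G x y => //= g G IH x y; rewrite IH dotDl mulrDl scalerDl opprD.
by rewrite addrACA.
Qed.

Lemma resZ G c x : res G (c *: x) = c *: res G x.
Proof.
by elim: G x => //= g G IH x; rewrite IH dotZl scalerBr !scalerA mulrA.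
Qed.

(** [res G] is an orthogonal projection: one identity packs self-adjointness and idempotence, and
    the later facts on residuals rest on it. *)
Lemma res_selfadj G x y : dot (res G x) y = dot (res G x) (res G y).
Proof.
elim: G x y => //= g G IH x y.
set a := res G x; set b := res G g; set d := res G y.
(* If [b] is null the subtracted multiple of [b] vanishes whatever its coefficient, so linearly
   dependent families are allowed. *)
have [/dot_eq0->|b0] := eqVneq (dot b b) 0.
  by rewrite !scaler0 !subr0 IH.
have orth : dot (a - (dot a b / dot b b) *: b) b = 0.
  by rewrite !dotE divfK ?subrr.
rewrite [RHS]dotDr dotNr dotZr orth mulr0 subr0 !dotE.
by rewrite /a /b /d (IH x y) (IH g y).
Qed.

Lemma res_in G g : g \in G -> res G g = 0.
Proof.
elim: G => //= h G IH; rewrite inE => /predU1P[->|/IH->].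
  have [/dot_eq0->|b0] := eqVneq (dot (res G h) (res G h)) 0.
    by rewrite scaler0 subr0.
  by rewrite divff// scale1r subrr.
by rewrite dot0l mul0r scale0r subr0.
Qed.

Lemma res_orth G x g : g \in G -> dot (res G x) g = 0.
Proof. by move=> gG; rewrite res_selfadj (res_in gG) dot0r. Qed.

Lemma res_id G x : (forall g, g \in G -> dot x g = 0) -> res G x = x.
Proof.
elim: G => //= g G IH xG.
have xE : res G x = x by apply: IH => h hG; apply: xG; rewrite inE hG orbT.
by rewrite xE -{2}xE -res_selfadj xE xG ?mem_head// mul0r scale0r subr0.
Qed.

Lemma res_res G H x : {subset H <= G} -> res G (res H x) = res G x.
Proof.
elim: H x => //= h H IH x HG.
have sHG : {subset H <= G} by move=> y yH; apply: HG; rewrite inE yH orbT.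
by rewrite -scaleNr resD resZ !IH// (res_in (HG h (mem_head _ _))) scaler0 addr0.
Qed.

(** For jointly Gaussian functionals with covariance [dot], this is the conditional variance of [x]
    given [G]. *)
Definition cvar (G : seq V) (x : V) : F := dot (res G x) (res G x).

Lemma cvar_ge0 G x : 0 <= cvar G x. Proof. exact: dot_ge0. Qed.

(** By [res_res] the residual over the smaller family may replace [x]; it remains that a projection
    does not lengthen a vector. *)
Lemma cvar_subset G H x : {subset H <= G} -> cvar G x <= cvar H x.
Proof.
move=> HG; rewrite /cvar -(res_res x HG); set y := res H x.
have := dot_ge0 (y - res G y).
by rewrite !dotE (dotC y (res G y)) res_selfadj; lra.
Qed.

Lemma cvar_eq_mem G H x : G =i H -> cvar G x = cvar H x.
Proof. by move=> GH; apply/le_anti/andP; split; apply: cvar_subset => y; rewrite GH. Qed.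

Lemma cvar_cons g G x : cvar G g != 0 ->
  cvar (g :: G) x = cvar G x - dot (res G x) (res G g) ^+ 2 / cvar G g.
Proof.
rewrite /cvar/= => g0; rewrite !dotE (dotC (res G g) (res G x)).
by field.
Qed.

Lemma cvar_addnoise G x z : dot x z = 0 -> (forall g, g \in G -> dot z g = 0) ->
  cvar G (x + z) = cvar G x + dot z z.
Proof.
move=> xz zG; have zE := res_id zG.
have rz : dot (res G x) z = 0.
  by rewrite -xz dotC -[in LHS]zE -res_selfadj zE dotC.
by rewrite /cvar resD zE !dotE (dotC z) rz !addr0 add0r.
Qed.

(** The Gram determinant, written as the chain rule for Gaussian entropy; that the order does not
    matter is [perm_gramdet]. *)
Fixpoint gramdet (G : seq V) : F :=
  if G is g :: G' then cvar G' g * gramdet G' else 1.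

Lemma gramdet_ge0 G : 0 <= gramdet G.
Proof. by elim: G => //= g G IH; rewrite mulr_ge0// cvar_ge0. Qed.

(** Both sides are the 2x2 Gram determinant of [res G x] and [res G y], times [gramdet G]. Null
    residuals are treated apart because [cvar_cons] divides. *)
Lemma gramdet_swap x y G : gramdet (x :: y :: G) = gramdet (y :: x :: G).
Proof.
rewrite /=; have [y0|y0] := eqVneq (cvar G y) 0.
  have r0 := dot_eq0 y0; have -> : cvar (x :: G) y = 0.
    by rewrite /cvar/= r0 dot0l mul0r scale0r subr0 dot0l.
  by rewrite y0 !mul0r mulr0.
have [x0|x0] := eqVneq (cvar G x) 0.
  have r0 := dot_eq0 x0; have -> : cvar (y :: G) x = 0.
    by rewrite /cvar/= r0 dot0l mul0r scale0r subr0 dot0l.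
  by rewrite x0 !mul0r mulr0.
rewrite !cvar_cons// (dotC (res G y)); field.
by rewrite x0 y0.
Qed.

Lemma gramdet_move x G H : gramdet (G ++ x :: H) = gramdet (x :: G ++ H).
Proof.
elim: G => //= y G IH; rewrite IH.
transitivity (gramdet [:: y, x & G ++ H]); last by rewrite gramdet_swap.
congr (_ * _); apply: cvar_eq_mem => z.
by rewrite !(inE, mem_cat) orbCA.
Qed.

Lemma perm_gramdet G H : perm_eq G H -> gramdet G = gramdet H.
Proof.
elim: G H => [|x G IH] H; first by move=> /perm_size/esym/size0nil->.
move=> GH; have xH : x \in H by rewrite -(perm_mem GH) mem_head.
case/splitPr: xH GH => H1 H2 GH.
have GH' : perm_eq G (H1 ++ H2).
  rewrite -(perm_cons x); apply: perm_trans GH _.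
  by rewrite -[x :: H2]cat1s perm_catCA.
rewrite gramdet_move /= (IH _ GH'); congr (_ * _).
exact/cvar_eq_mem/perm_mem.
Qed.

(** The residual of [y j] given the other vectors, divided by [rho j], is the dual vector of [y j].
    The factor [n] is the crude cost of not using orthogonality among these residuals. *)
Lemma dual_basis (n : nat) (y : 'I_n -> V) (h : 'I_n -> F) (rho : 'I_n -> F) :
  (forall j, rho j = cvar [seq y i | i <- enum 'I_n & i != j] (y j)) ->
  (forall j, 0 < rho j) ->
  exists w, (forall i, dot (y i) w = h i) /\
    dot w w <= n%:R * \sum_i h i ^+ 2 / rho i.
Proof.
move=> rhoE rho_gt0.
pose r j := res [seq y i | i <- enum 'I_n & i != j] (y j).
have ry i j : dot (y i) (r j) = if i == j then rho j else 0.
  rewrite dotC; have [->|ij] := eqVneq i j; first by rewrite rhoE res_selfadj.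
  by apply: res_orth; apply: map_f; rewrite mem_filter ij mem_enum.
exists (\sum_j (h j / rho j) *: r j); split => [i|].
  rewrite dot_sumr (bigD1 i)//= dotZr ry eqxx divfK ?gt_eqF//.
  rewrite big1 ?addr0// => j ji.
  by rewrite dotZr ry eq_sym (negbTE ji) mulr0.
apply: le_trans (dot_sum_le _) _; rewrite ler_wpM2l// ?ler0n//.
apply: ler_sum => i _; rewrite !dotE.
have -> : dot (r i) (r i) = rho i by rewrite rhoE.
by rewrite divfK ?gt_eqF// expr2 mulrAC lexx.
Qed.

End InnerProduct.

(** * The chain of Gram determinants *)

Section Channel.
Variables (F : realFieldType) (V : lmodType F) (dot : V -> V -> F).
Hypothesis dotC : forall x y, dot x y = dot y x.
Hypothesis dotDl : forall x y z, dot (x + y) z = dot x z + dot y z.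
Hypothesis dotZl : forall c x z, dot (c *: x) z = c * dot x z.
Hypothesis dot_ge0 : forall x, 0 <= dot x x.
Hypothesis dot_eq0 : forall x, dot x x = 0 -> x = 0.

Variables (K n : nat) (s2 : nat -> F) (x : nat -> V) (e : nat -> nat -> V).
Hypothesis s2_gt0 : forall m, (1 <= m <= K)%N -> 0 < s2 m.
Hypothesis e_x : forall m i j, (1 <= m <= K)%N -> (j <= i < n)%N ->
  dot (e m i) (x j) = 0.
Hypothesis e_e : forall m i m' i', (1 <= m <= K)%N -> (1 <= m' <= K)%N ->
  (i < n)%N -> (i' < n)%N ->
  dot (e m i) (e m' i') = if (m == m') && (i == i') then s2 m else 0.

Local Notation cvar := (cvar dot).
Local Notation gramdet := (gramdet dot).

(* Output of receiver [m] at time [i] when the message point is 0. *)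
Definition obs m i : V := x i + e m i.

Lemma e_obs m i m' i' : (1 <= m <= K)%N -> (1 <= m' <= K)%N -> (i < n)%N ->
  (i' < i)%N || (i' == i) && (m' != m) -> dot (e m i) (obs m' i') = 0.
Proof.
move=> mK m'K i_n ii'; rewrite dotC dotDl !(dotC _ (e m i)) e_x ?add0r//; last first.
  by case/orP: ii' => [/ltnW->//|/andP[/eqP-> _]]; rewrite leqnn.
rewrite e_e//; last by case/orP: ii' => [|/andP[/eqP->]]//; lia.
by case: ifP => // /andP[/eqP mm /eqP]; lia.
Qed.

(** The precision of the optimal combination of receivers 1 to [k], that is, the inverse of [Nk]. *)
Definition tau k := \sum_(1 <= m < k.+1) (s2 m)^-1.
Definition s2prod k := \prod_(1 <= m < k.+1) s2 m.

Lemma tauS k : tau k.+1 = tau k + (s2 k.+1)^-1.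
Proof. by rewrite /tau big_nat_recr. Qed.

Lemma s2prodS k : s2prod k.+1 = s2prod k * s2 k.+1.
Proof. by rewrite /s2prod big_nat_recr. Qed.

Lemma tau_ge0 k : (k <= K)%N -> 0 <= tau k.
Proof.
move=> kK; rewrite /tau big_nat_cond sumr_ge0// => m mk.
by rewrite invr_ge0 ltW// s2_gt0//; lia.
Qed.

Lemma s2prod_gt0 k : (k <= K)%N -> 0 < s2prod k.
Proof.
by move=> kK; rewrite /s2prod big_nat_cond prodr_gt0// => m mk; apply: s2_gt0; lia.
Qed.

Fixpoint block k i : seq V :=
  if k is k'.+1 then obs k i :: block k' i else [::].

Fixpoint past k t : seq V :=
  if t is i.+1 then block k i ++ past k i else [::].

Lemma block_inv k i g : g \in block k i ->
  exists2 m, (1 <= m <= k)%N & g = obs m i.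
Proof.
elim: k => [//|k IH] /=; rewrite inE => /orP[/eqP->|gB].
  by exists k.+1; rewrite ?leqnn.
by have [m mk ->] := IH gB; exists m => //; lia.
Qed.

Lemma mem_block k i m : (1 <= m <= k)%N -> obs m i \in block k i.
Proof.
elim: k => [|k IH] mk /=; first by lia.
rewrite inE; have [->|mk1] := eqVneq m k.+1; first by rewrite eqxx.
by rewrite IH ?orbT//; lia.
Qed.

Lemma past_inv k t g : g \in past k t ->
  exists m i, [/\ (1 <= m <= k)%N, (i < t)%N & g = obs m i].
Proof.
elim: t => [//|t IH] /=; rewrite mem_cat => /orP[gB|gP].
  by have [m mk ->] := block_inv gB; exists m, t.
by have [m [i [mk it ->]]] := IH gP; exists m, i; split => //; exact: ltnW.
Qed.

Section Block.
Variables (G : seq V) (i : nat).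
Hypothesis i_n : (i < n)%N.
Hypothesis eG : forall m g, (1 <= m <= K)%N -> g \in G -> dot (e m i) g = 0.

Let xe m : (1 <= m <= K)%N -> dot (x i) (e m i) = 0.
Proof. by move=> mK; rewrite dotC e_x// leqnn. Qed.

Let eBG k g : (k < K)%N -> g \in block k i ++ G -> dot (e k.+1 i) g = 0.
Proof.
move=> kK; rewrite mem_cat => /orP[gB|]; last by apply: eG; lia.
have [m mk ->] := block_inv gB.
by apply: e_obs => //; lia.
Qed.

(** Each observation with independent noise adds its precision [1 / s2] to the inverse of the
    conditional variance. [G] is general because the lemma serves both [past] and [past_but]. *)
Lemma cvar_block k : (k <= K)%N ->
  cvar (block k i ++ G) (x i) = cvar G (x i) / (1 + tau k * cvar G (x i)).
Proof.
elim: k => [|k IH] kK.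
  by rewrite /tau big_geq// mul0r addr0 divr1.
set v := cvar G (x i) in IH *; have v0 : 0 <= v by exact: cvar_ge0.
have s0 := s2_gt0 (m := k.+1) kK.
have eq1 := @eBG k _ kK; have xz := @xe k.+1 kK.
have eE : res dot (block k i ++ G) (e k.+1 i) = e k.+1 i.
  by apply: res_id => // g /eq1.
have ts := tau_ge0 (ltnW kK); have t1 : 0 < 1 + tau k * v.
  by rewrite ltr_pwDl// mulr_ge0.
have u0 : 0 <= v / (1 + tau k * v) by rewrite divr_ge0// ltW.
have cy : cvar (block k i ++ G) (obs k.+1 i) = v / (1 + tau k * v) + s2 k.+1.
  by rewrite (cvar_addnoise dotC)// ?IH ?e_e ?eqxx// ltnW.
rewrite /= cvar_cons//; last by rewrite cy gt_eqF// ltr_wpDl.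
have rxe : dot (res dot (block k i ++ G) (x i)) (e k.+1 i) = 0.
  rewrite dotC. rewrite -eE. rewrite -res_selfadj//. by rewrite eE dotC.
rewrite cy /obs resD// eE (dotDr dotC dotDl) rxe addr0.
rewrite -/(cvar (block k i ++ G) (x i)) IH; last exact: ltnW.
rewrite tauS; move: (tau k) (s2 k.+1) v s0 v0 t1 u0 ts {IH cy} => t s w s0 w0 t1 u0 ts.
by field; rewrite !gt_eqF//= ltr_wpDr// mulr_ge0// addr_ge0// mulr_ge0// ltW.
Qed.

(** Receiver [k.+1] contributes [s2 k.+1 * (1 + tau k.+1 * v) / (1 + tau k * v)], with [v] the
    variance given [G], so the product over receivers telescopes. *)
Lemma gramdet_block k : (k <= K)%N ->
  gramdet (block k i ++ G) =
  s2prod k * (1 + tau k * cvar G (x i)) * gramdet G.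
Proof.
elim: k => [|k IH] kK.
  by rewrite /tau /s2prod !big_geq// mul0r addr0 !mul1r.
have s0 := s2_gt0 (m := k.+1) kK.
have t1 : 0 < 1 + tau k * cvar G (x i).
  rewrite ltr_pwDl//; apply: mulr_ge0; first exact/tau_ge0/ltnW.
  exact: (cvar_ge0 dot_ge0).
have cy : cvar (block k i ++ G) (obs k.+1 i) =
    cvar G (x i) / (1 + tau k * cvar G (x i)) + s2 k.+1.
  have H : forall g, g \in block k i ++ G -> dot (e k.+1 i) g = 0.
    by move=> g; exact: eBG.
  rewrite /obs (cvar_addnoise dotC dotDl dotZl dot_eq0 (@xe k.+1 kK) H).
  rewrite e_e ?eqxx// cvar_block//; exact: ltnW.
rewrite [LHS]/= cy IH; last exact: ltnW.
rewrite s2prodS tauS.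
move: (tau k) (s2 k.+1) (cvar _ _) (gramdet _) s0 t1 {IH cy} => t s w d s0 t1.
by field; rewrite !gt_eqF.
Qed.
End Block.

Local Notation V_ k i := (cvar (past k i) (x i)).

Lemma e_past k t m i g : (k <= K)%N -> (1 <= m <= K)%N -> (t <= i < n)%N ->
  g \in past k t -> dot (e m i) g = 0.
Proof.
move=> kK mK ti gP; have [m' [i' [mk it ->]]] := past_inv gP.
by apply: e_obs => //; lia.
Qed.

Lemma gramdet_past k t : (k <= K)%N -> (t <= n)%N ->
  gramdet (past k t) = \prod_(i < t) (s2prod k * (1 + tau k * V_ k i)).
Proof.
move=> kK; elim: t => [|t IH] tn; first by rewrite big_ord0.
rewrite [past k t.+1]/= gramdet_block//; last first.
  by move=> m g mK; apply: e_past => //; rewrite leqnn.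
by rewrite IH ?(ltnW tn)// big_ord_recr/= mulrC.
Qed.

(** [past k.+1 t] without output [j] of receiver [k.+1]. It stays in causal order, so
    [gramdet_block] can still peel off one time after another. *)
Fixpoint past_but k j t : seq V :=
  if t is i.+1 then block (if i == j then k else k.+1) i ++ past_but k j i
  else [::].

Lemma past_but_small k j t : (t <= j)%N -> past_but k j t = past k.+1 t.
Proof.
elim: t => //= t IH tj; rewrite IH; last exact: ltnW.
by rewrite ltn_eqF.
Qed.

Lemma perm_past_but k j t : (j < t)%N ->
  perm_eq (past k.+1 t) (obs k.+1 j :: past_but k j t).
Proof.
elim: t => //= t IH; rewrite ltnS leq_eqVlt => /orP[/eqP<-|jt].
  by rewrite eqxx past_but_small.
rewrite gtn_eqF// -[in X in perm_eq _ X]cat1s perm_sym perm_catCA perm_sym.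
by rewrite /= !perm_cons perm_cat2l IH.
Qed.

Lemma past_but_inv k j t g : g \in past_but k j t ->
  exists m i, [/\ (1 <= m <= k.+1)%N, (i < t)%N & g = obs m i].
Proof.
elim: t => [//|t IH]; rewrite [past_but _ _ _]/= mem_cat => /orP[gB|gP].
  have [m mk ->] := block_inv gB; exists m, t; split => //.
  by move: mk; case: ifP => _; lia.
by have [m [i [mk it ->]]] := IH gP; exists m, i; split => //; exact: ltnW.
Qed.

Lemma mem_past_but k j t m i : (1 <= m <= k.+1)%N -> (i < t)%N ->
  (m <= k)%N || (i != j) -> obs m i \in past_but k j t.
Proof.
elim: t => [//|t IH] mk it mij; rewrite [past_but _ _ _]/= mem_cat.
have [ti|ti] := eqVneq i t; last by rewrite IH ?orbT//; lia.
rewrite ti mem_block//; move: mij; rewrite ti.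
by case: (eqVneq t j) => _; rewrite ?orbF => ?; lia.
Qed.

(** At each time the conditioning family contains [past k], so forgetting the past of receiver
    [k.+1] only raises the variance; this brings in [V_ k] in place of [V_ k.+1]. At time [j] the
    factor has [tau k], which is raised to [tau k.+1] for uniformity. *)
Lemma gramdet_past_but k j t : (k.+1 <= K)%N -> (t <= n)%N ->
  gramdet (past_but k j t) <=
  \prod_(i < t) (s2prod (if i == j :> nat then k else k.+1) *
                 (1 + tau k.+1 * V_ k i)).
Proof.
move=> kK; elim: t => [|t IH] tn; first by rewrite big_ord0.
rewrite [past_but k j t.+1]/= gramdet_block//; last 2 first.
- by move=> m g mK /past_but_inv[m' [i' [mk it ->]]]; apply: e_obs => //; lia.
- by case: ifP => _ //; exact: ltnW.
rewrite big_ord_recr/= mulrC; apply: ler_pM.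
- exact: (gramdet_ge0 dot_ge0).
- apply: mulr_ge0; first by apply/ltW/s2prod_gt0; case: ifP => _ //; exact: ltnW.
  apply: addr_ge0 => //; apply: mulr_ge0; last exact: (cvar_ge0 dot_ge0).
  by apply: tau_ge0; case: ifP => _ //; exact: ltnW.
- exact/IH/ltnW.
have kk : ((if t == j then k else k.+1) <= K)%N by case: ifP => _ //; exact: ltnW.
rewrite (ler_pM2l (s2prod_gt0 kk)) lerD2l; apply: ler_pM.
- exact: tau_ge0.
- exact: (cvar_ge0 dot_ge0).
- case: ifP => _ //; rewrite tauS lerDl invr_ge0; exact/ltW/s2_gt0.
- apply: (cvar_subset dotC dotDl dotZl dot_ge0 dot_eq0) => g gP.
  have [m [i [mk it ->]]] := past_inv gP.
  by apply: mem_past_but => //; lia.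
Qed.

Definition others k j : seq V := [seq obs k i | i : 'I_n <- enum 'I_n & i != j].

(* Expand the Gram determinant of all outputs of receivers 1, ..., k+1 in two
   ways: in causal order, and with output [j] of receiver [k.+1] put last, where
   the remaining outputs are then bounded causally by conditioning only on the
   past of receivers 1, ..., k. *)
Lemma past_chain k (j : 'I_n) : (k.+1 <= K)%N ->
  s2 k.+1 * \prod_(i < n) (1 + tau k.+1 * V_ k.+1 i) <=
  cvar (others k.+1 j) (obs k.+1 j) * \prod_(i < n) (1 + tau k.+1 * V_ k i).
Proof.
move=> kK; have sk := s2prod_gt0 kK; have s0 := s2_gt0 (m := k.+1) kK.
have := gramdet_past kK (leqnn n).
rewrite (perm_gramdet dotC dotDl dotZl dot_ge0 dot_eq0 (perm_past_but _ (ltn_ord j))) [LHS]/=.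
rewrite big_split/= prodr_const card_ord => E.
(* Conditioning on the other outputs of receiver [k.+1] alone gives the larger residual, and it is
   the one that decoding controls. *)
have H1 : cvar (past_but k j n) (obs k.+1 j) <= cvar (others k.+1 j) (obs k.+1 j).
  apply: (cvar_subset dotC dotDl dotZl dot_ge0 dot_eq0) => g /mapP[i].
  rewrite mem_filter => /andP[ij _] ->; apply: mem_past_but => //.
  - by rewrite ltnSn.
  - by rewrite ij orbT.
have H2 := gramdet_past_but j kK (leqnn n).
have H3 := ler_pM (cvar_ge0 dot_ge0 _ _) (gramdet_ge0 dot_ge0 _) H1 H2.
move: H3; rewrite E big_split/=.
(* The block at time [j] misses receiver [k.+1], hence one factor [s2 k.+1]; it ends up on the left
   of the claim. *)
have -> : \prod_(i < n) s2prod (if i == j :> nat then k else k.+1) =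
    s2prod k.+1 ^+ n / s2 k.+1.
  have -> : s2prod k.+1 ^+ n = s2prod k.+1 * \prod_(i < n | i != j) s2prod k.+1.
    by rewrite -[in LHS](card_ord n) -prodr_const (bigD1 j).
  rewrite (bigD1 j)//= eqxx s2prodS mulrAC mulfK ?gt_eqF//; congr (_ * _).
  by apply: eq_bigr => i ij; rewrite -s2prodS val_eqE (negbTE ij).
have Sn : 0 < s2prod k.+1 ^+ n / s2 k.+1 by rewrite divr_gt0// exprn_gt0.
move=> H3; rewrite -(ler_pM2l Sn) [leLHS]mulrA divfK ?gt_eqF//.
by rewrite [leRHS]mulrCA.
Qed.

Fixpoint single k t : seq V := if t is i.+1 then obs k i :: single k i else [::].

(** In causal order every output carries fresh noise, so every residual is at least [s2 k]. *)
Lemma single_gt0 k t : (1 <= k <= K)%N -> (t <= n)%N -> 0 < gramdet (single k t).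
Proof.
move=> kK; elim: t => [|t IH] tn; first exact: ltr01.
rewrite [gramdet _]/=; apply: mulr_gt0; last exact/IH/ltnW.
have xe : dot (x t) (e k t) = 0 by rewrite dotC e_x// leqnn.
have H g : g \in single k t -> dot (e k t) g = 0.
  move=> gt; have [i it ->] : exists2 i, (i < t)%N & g = obs k i.
    elim: {IH xe tn} t gt => //= t IH; rewrite inE => /orP[/eqP->|/IH[i it ->]].
      by exists t.
    by exists i => //; exact: ltnW.
  by apply: e_obs => //; rewrite it.
rewrite /obs (cvar_addnoise dotC dotDl dotZl dot_eq0 xe H) e_e// !eqxx.
by apply: ltr_wpDl; [exact: (cvar_ge0 dot_ge0)|exact: s2_gt0].
Qed.

(** [others] contains later outputs too, so fresh noise gives no direct bound. But the determinant
    is positive in causal order, hence also with output [j] in front, and then no factor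
    vanishes. *)
Lemma others_gt0 k (j : 'I_n) : (1 <= k <= K)%N ->
  0 < cvar (others k j) (obs k j).
Proof.
move=> kK; have := single_gt0 kK (leqnn n).
have sE : single k n = [seq obs k i | i <- rev (iota 0 n)].
  elim: n => [//|t IH].
  by rewrite -(addn1 t) iotaD rev_cat map_cat -IH addn1.
have pE : perm_eq (single k n) (obs k j :: others k j).
  rewrite sE -val_enum_ord -map_rev -map_comp.
  apply: (@perm_trans _ [seq obs k i | i : 'I_n <- enum 'I_n]).
    by apply: perm_map; rewrite perm_rev.
  rewrite -[_ :: _]/(map (fun i : 'I_n => obs k i) (j :: [seq i <- enum 'I_n | i != j])).
  apply: perm_map; rewrite -rem_filter ?enum_uniq//.
  by apply: perm_to_rem; rewrite mem_enum.
rewrite (perm_gramdet dotC dotDl dotZl dot_ge0 dot_eq0 pE) [gramdet _]/=.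
have := gramdet_ge0 dot_ge0 (others k j); rewrite le0r => /orP[/eqP->|g0].
  by rewrite mulr0 ltxx.
by rewrite pmulr_lgt0.
Qed.
End Channel.

(** * One-dimensional Gaussian integrals *)

Section Gaussian.
Local Open Scope classical_set_scope.
Variable R : realType.
Local Notation mu := (@lebesgue_measure R).

(** The Radon-Nikodym derivative of [normal_prob] and [normal_pdf] have the same integral over every
    measurable set, hence agree almost everywhere. *)
Lemma ge0_integral_normal_prob (m s : R) (f : R -> \bar R) :
  measurable_fun [set: R] f -> (forall x, 0 <= f x)%E ->
  (\int[normal_prob m s]_x f x = \int[mu]_x (f x * (normal_pdf m s x)%:E))%E.
Proof.
move=> mf f0; have dom := normal_prob_dominates m s.
rewrite -(Radon_Nikodym_SigmaFinite.change_of_variables dom)//=.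
have mpdf : measurable_fun [set: R] (fun x : R => (normal_pdf m s x)%:E).
  by apply/measurable_EFinP; exact: measurable_normal_pdf.
have iRN := Radon_Nikodym_SigmaFinite.f_integrable dom.
apply: ae_eq_integral => //.
- by apply: emeasurable_funM => //; exact: measurable_int iRN.
- exact: emeasurable_funM.
- apply: ae_eqe_mul2l; apply: integral_ae_eq => //= A _ mA.
  by rewrite -Radon_Nikodym_SigmaFinite.f_integral.
Qed.

Lemma ge0_integral_shift (c : R) (f : R -> \bar R) :
  measurable_fun [set: R] f -> (forall x, 0 <= f x)%E ->
  (\int[mu]_x f (x + c)%R = \int[mu]_x f x)%E.
Proof.
move=> mf f0.
have mD : measurable_fun [set: R] (fun x : R => x + c : measurableTypeR R).
  exact: measurable_funD.
pose phi : {mfun R >-> measurableTypeR R} :=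
  HB.pack (fun x : R => x + c : measurableTypeR R)
    (isMeasurableFun.Build _ _ _ _ _ mD).
have muD A : measurable A -> mu A = pushforward mu phi A.
  move=> mA; apply: lebesgue_measure_unique => //= _ [[a b]] _ <-.
  rewrite /pushforward/=.
  have -> : (fun x : R => x + c) @^-1` `]a, b] = `]a - c, b - c]%classic.
    apply/seteqP; split => x /=; rewrite !in_itv/= => /andP[? ?].
      by apply/andP; split; lra.
    by apply/andP; split; lra.
  rewrite !lebesgue_measure_itv/= !lte_fin ltrD2r.
  by case: ifP => // _; congr EFin; rewrite opprB addrA subrK.
transitivity (\int[pushforward mu phi]_x f x)%E.
  by rewrite ge0_integral_pushforward.
by apply: eq_measure_integral => A mA _; exact/esym/muD.
Qed.

Lemma ge0_integral_opp (f : R -> \bar R) :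
  measurable_fun [set: R] f -> (forall x, 0 <= f x)%E ->
  (\int[mu]_x f (- x)%R = \int[mu]_x f x)%E.
Proof.
move=> mf f0.
transitivity (\int[pushforward mu (-%R : R -> measurableTypeR R)]_x f x)%E.
  by rewrite ge0_integral_pushforward.
by apply: eq_measure_integral => A mA _; exact: lebesgue_measureN.
Qed.

(** One-dimensional Cameron-Martin formula: translate the Lebesgue integral and complete the
    square. *)
Lemma ge0_integral_normal_shift (c s : R) (f : R -> \bar R) : s != 0 ->
  measurable_fun [set: R] f -> (forall x, 0 <= f x)%E ->
  (\int[normal_prob 0 s]_x f (x + c)%R =
   \int[normal_prob 0 s]_x (f x * (expR (c * x / s ^+ 2 - c ^+ 2 / (s ^+ 2 *+ 2)))%:E))%E.
Proof.
move=> s0 mf f0.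
have me : measurable_fun [set: R]
    (fun x => (expR (c * x / s ^+ 2 - c ^+ 2 / (s ^+ 2 *+ 2)))%:E).
  apply/measurable_EFinP/measurableT_comp => //=.
  apply: measurable_funB; last exact: measurable_cst.
  apply: measurable_funM; last exact: measurable_cst.
  exact: measurable_funM.
rewrite !ge0_integral_normal_prob//; last 3 first.
- exact: emeasurable_funM.
- by move=> x; rewrite mule_ge0// lee_fin expR_ge0.
- by apply: (measurableT_comp mf); exact: measurable_funD.
have := @ge0_integral_shift c (fun x : R =>
  (f x * (expR (c * x / s ^+ 2 - c ^+ 2 / (s ^+ 2 *+ 2)))%:E * (normal_pdf 0 s x)%:E)%E).
move=> <-; last 2 first.
- apply: emeasurable_funM; first exact: emeasurable_funM.
  by apply/measurable_EFinP; exact: measurable_normal_pdf.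
- by move=> x; rewrite !mule_ge0// lee_fin ?expR_ge0// normal_pdf_ge0.
apply: eq_integral => x _; rewrite -muleA -EFinM; congr (_ * _%:E)%E.
rewrite !normal_pdfE// /normal_fun mulrCA -expRD; congr (_ * expR _).
by field.
Qed.

Lemma ge0_integral_normal_opp (s : R) (f : R -> \bar R) : s != 0 ->
  measurable_fun [set: R] f -> (forall x, 0 <= f x)%E ->
  (\int[normal_prob 0 s]_x f (- x)%R = \int[normal_prob 0 s]_x f x)%E.
Proof.
move=> s0 mf f0.
rewrite !ge0_integral_normal_prob//; last exact: measurableT_comp.
have := @ge0_integral_opp (fun x : R => (f x * (normal_pdf 0 s x)%:E)%E).
move=> <-; last 2 first.
- apply: emeasurable_funM => //.
  by apply/measurable_EFinP; exact: measurable_normal_pdf.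
- by move=> x; rewrite !mule_ge0// lee_fin normal_pdf_ge0.
apply: eq_integral => x _; congr (_ * _%:E)%E.
by rewrite !normal_pdfE// /normal_fun !subr0 sqrrN.
Qed.

(** The integrand times the density of deviation [s] is [1 / r] times the density of deviation
    [s / r]. *)
Lemma integral_normal_gauss (t s : R) : 0 < s -> 0 < t ->
  (\int[normal_prob 0 s]_x (expR (- (t * x ^+ 2)))%:E =
   ((Num.sqrt (1 + 2 * t * s ^+ 2))^-1)%:E)%E.
Proof.
move=> s0 t0; set r := Num.sqrt _.
have r20 : 0 < 1 + 2 * t * s ^+ 2 by rewrite addr_gt0// !mulr_gt0// exprn_gt0.
have r0 : 0 < r by rewrite sqrtr_gt0.
have rE : r ^+ 2 = 1 + 2 * t * s ^+ 2 by rewrite sqr_sqrtr// ltW.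
have sr0 : 0 < s / r by rewrite divr_gt0.
rewrite ge0_integral_normal_prob; last 2 first.
- apply/measurable_EFinP/measurableT_comp => //=.
  by apply: measurableT_comp => //=; apply: measurable_funM => //; exact: measurable_funX.
- by move=> x; rewrite lee_fin expR_ge0.
transitivity (\int[mu]_x (r^-1%:E * (normal_pdf 0 (s / r) x)%:E))%E; last first.
  rewrite ge0_integralZl//; first by rewrite integral_normal_pdf mule1.
  - by apply/measurable_EFinP; exact: measurable_normal_pdf.
  - by move=> x _; rewrite lee_fin normal_pdf_ge0.
  - by rewrite lee_fin invr_ge0 ltW.
apply: eq_integral => x _; rewrite -!EFinM; congr EFin.
  rewrite !normal_pdfE ?gt_eqF// mulrCA /normal_fun -expRD [RHS]mulrA.
  congr (_ * expR _).
    rewrite /normal_peak expr_div_n.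
    have pi2 : 0 <= s ^+ 2 * pi *+ 2 :> R.
      by rewrite mulrn_wge0// mulr_ge0 ?sqr_ge0// pi_ge0.
    rewrite (_ : (s ^+ 2 / r ^+ 2 * pi) *+ 2 = (s ^+ 2 * pi *+ 2) / r ^+ 2); last first.
      by field; rewrite gt_eqF.
    rewrite sqrtrM// sqrtrV ?sqr_ge0// sqrtr_sqr gtr0_norm// invfM invrK.
    by rewrite mulrCA mulVf ?mulr1// gt_eqF.
  rewrite !subr0 expr_div_n rE; field.
  by rewrite !gt_eqF.
Qed.

Lemma integral_normal_cst (s c : R) : (\int[normal_prob 0 s]_x c%:E = c%:E)%E.
Proof. by rewrite integral_cst//= /normal_prob integral_normal_pdf mule1. Qed.

(** In terms of [t = sqrt (1 + u) - 1] the claim is the nonnegativity of a polynomial in [t] with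
    nonnegative coefficients. *)
Lemma inv_sqrt_le (u : R) : 0 <= u ->
  (Num.sqrt (1 + u))^-1 <= 1 - u / 2 + u ^+ 2 / 2.
Proof.
move=> u0; set w := Num.sqrt _.
have w2 : w ^+ 2 = 1 + u by rewrite sqr_sqrtr// addr_ge0.
have w0 : 0 <= w by exact: sqrtr_ge0.
have w1 : 1 <= w by rewrite -sqrtr1 ler_sqrt ?ltr01 ?lerDl// addr_ge0.
have -> : u = w ^+ 2 - 1 by rewrite w2 addrC addKr.
have wp : 0 < w by apply: lt_le_trans w1.
rewrite -(ler_pM2l wp) mulfV ?gt_eqF//.
have : 0 <= w - 1 by rewrite subr_ge0.
move: (w - 1) (subrK 1 w) => t <- t0.
have t2 := mulr_ge0 t0 t0; have t3 := mulr_ge0 t0 t2.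
have t4 := mulr_ge0 t0 t3; have t5 := mulr_ge0 t0 t4.
by lra.
Qed.

(** Follows from [integral_normal_gauss] as [t] tends to 0. A lower bound suffices, since the power
    constraint bounds the energy from above. *)
Lemma normal_second_moment_ge (s : R) : 0 < s ->
  ((s ^+ 2)%:E <= \int[normal_prob 0 s]_x (x ^+ 2)%:E)%E.
Proof.
move=> s0.
have mx2 : measurable_fun [set: R] (fun x : R => (x ^+ 2)%:E).
  by apply/measurable_EFinP; exact: measurable_funX.
have x20 (x : R) : (0 <= (x ^+ 2)%:E)%E by rewrite lee_fin sqr_ge0.
have bound (t : R) : 0 < t ->
    (1%:E <= t%:E * \int[normal_prob 0 s]_x (x ^+ 2)%:E
             + ((Num.sqrt (1 + 2 * t * s ^+ 2))^-1)%:E)%E.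
  move=> t0; rewrite -integral_normal_gauss//.
  have mg : measurable_fun [set: R] (fun x : R => (expR (- (t * x ^+ 2)))%:E).
    apply/measurable_EFinP/measurableT_comp => //=.
    by apply: measurableT_comp => //=; apply: measurable_funM => //; exact: measurable_funX.
  rewrite -ge0_integralZl//; last by rewrite lee_fin ltW.
  rewrite -ge0_integralD//; last 2 first.
  - by move=> x _; rewrite mule_ge0// lee_fin ltW.
  - exact: measurable_funeM.
  (* 1 - t x^2 <= exp (- t x^2), whose Gaussian integral is explicit *)
  rewrite -(integral_normal_cst s 1).
  apply: ge0_le_integral => //.
  - by apply: emeasurable_funD => //; exact: measurable_funeM.
  - move=> x _; rewrite -EFinM -EFinD lee_fin.
    have := expR_ge1Dx (- (t * x ^+ 2)); lra.
have I0 : (0 <= \int[normal_prob 0 s]_x (x ^+ 2)%:E)%E by exact: integral_ge0.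
case: (\int[_]_x _)%E bound I0 => [I bound I0|_ _|//]; last exact: leey.
rewrite lee_fin; apply/ler_addgt0Pr => e e0.
have s4 : 0 < 2 * s ^+ 4 by rewrite mulr_gt0// exprn_gt0.
(* This [t] makes the quadratic remainder of [inv_sqrt_le], namely [2 t^2 s^4], equal to [t e]. *)
have t0 : 0 < e / (2 * s ^+ 4) by rewrite divr_gt0.
have := bound _ t0; rewrite -EFinM -EFinD lee_fin => b.
have u0 : 0 <= 2 * (e / (2 * s ^+ 4)) * s ^+ 2.
  by rewrite mulr_ge0 ?sqr_ge0// mulr_ge0// ltW.
have := inv_sqrt_le u0; set t := e / _ in b t0 u0 *.
have -> : (2 * t * s ^+ 2) ^+ 2 / 2 = t * e.
  by rewrite /t; field; rewrite gt_eqF.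
move=> b2; rewrite -(ler_pM2l t0); lra.
Qed.

(** Adding the integral to its mirror image under [x -> -x] removes the cross term while all
    integrands stay nonnegative. In the induction over coordinates, [q] holds the variance of the
    remaining ones. *)
Lemma normal_affine_moment_ge (s c a q : R) : 0 < s -> 0 <= q ->
  ((c ^+ 2 + a ^+ 2 * s ^+ 2 + q)%:E <=
   \int[normal_prob 0 s]_x ((c + a * x) ^+ 2 + q)%:E)%E.
Proof.
move=> s0 q0.
have mf : measurable_fun [set: R] (fun x : R => ((c + a * x) ^+ 2 + q)%:E).
  apply/measurable_EFinP/measurable_funD => //; apply: measurable_funX.
  by apply: measurable_funD => //; exact: measurable_funM.
have f0 (x : R) : (0 <= ((c + a * x) ^+ 2 + q)%:E)%E.
  by rewrite lee_fin addr_ge0// sqr_ge0.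
have mx2 : measurable_fun [set: R] (fun x : R => (x ^+ 2)%:E).
  by apply/measurable_EFinP; exact: measurable_funX.
set I := (\int[_]_x _)%E.
have II : (I + I = (2 * (c ^+ 2 + q))%:E +
    (2 * a ^+ 2)%:E * \int[normal_prob 0 s]_x (x ^+ 2)%:E)%E.
  have sn0 : s != 0 by rewrite gt_eqF.
  have IN : (I = \int[normal_prob 0 s]_x ((c + a * - x) ^+ 2 + q)%:E)%E.
    exact/esym/(ge0_integral_normal_opp sn0 mf f0).
  rewrite {2}IN -ge0_integralD//; last by apply: (measurableT_comp mf).
  rewrite -(integral_normal_cst s (2 * (c ^+ 2 + q))) -ge0_integralZl//; last 2 first.
  - by move=> x _; rewrite lee_fin sqr_ge0.
  - by rewrite lee_fin mulr_ge0// sqr_ge0.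
  rewrite -ge0_integralD//; last 3 first.
  - by move=> x _; rewrite lee_fin mulr_ge0// addr_ge0// sqr_ge0.
  - move=> x _; rewrite -EFinM lee_fin; apply: mulr_ge0; last exact: sqr_ge0.
    by apply: mulr_ge0 => //; exact: sqr_ge0.
  - by apply: measurable_funeM => //; exact: mx2.
  apply: eq_integral => x _; rewrite -EFinM -!EFinD; congr EFin; ring.
have := normal_second_moment_ge s0.
have I0 : (0 <= I)%E by exact: integral_ge0.
case: (\int[_]_x _)%E I I0 II => // [m|] [I||]//= I0.
- rewrite -EFinM -!EFinD => -[II]; rewrite !lee_fin => sm.
  have := ler_wpM2l (sqr_ge0 a) sm; lra.
- have [->|a0] := eqVneq a 0.
    rewrite expr0n/= mulr0 mul0e adde0 -EFinD => -[II] _.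
    by rewrite lee_fin; lra.
  by rewrite gt0_muley// lte_fin mulr_gt0// exprn_even_gt0.
- by move=> _ _; rewrite leey.
Qed.
End Gaussian.

(** * Iterated Gaussian expectations *)

Section gexp.
Local Open Scope classical_set_scope.
Variable R : realType.
Implicit Types (sds z : seq R) (f g : seq R -> \bar R).

(** [gexp] evaluates its functional on lists of a single length, so measurability is asked on tuples
    of that length. *)
Definition seq_measurable (N : nat) f :=
  measurable_fun [set: N.-tuple R] (fun t : N.-tuple R => f t).

Lemma gexp_ge0 sds f : (forall z, 0 <= f z)%E -> (0 <= gexp sds f)%E.
Proof.
elim: sds f => [|s sds IH] f f0 /=; first exact: f0.
by apply: integral_ge0 => x _; exact: IH.
Qed.

Lemma eq_gexp sds f g : (forall z, size z = size sds -> f z = g z) ->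
  gexp sds f = gexp sds g.
Proof.
elim: sds f g => [|s sds IH] f g fg /=; first exact: fg.
by apply: eq_integral => x _; apply: IH => z sz; apply: fg; rewrite /= sz.
Qed.

(** The parameter space is general because the induction moves the integrated coordinates into it
    one by one; Tonelli's theorem then integrates each out again. *)
Lemma measurable_gexp d (T : measurableType d) sds (F : T -> seq R -> \bar R) :
  (forall t z, 0 <= F t z)%E ->
  measurable_fun [set: T * (size sds).-tuple R]
    (fun p : T * (size sds).-tuple R => F p.1 p.2) ->
  measurable_fun [set: T] (fun t => gexp sds (F t)).
Proof.
elim: sds d T F => [|s sds IH] d T F F0 mF /=.
  have := @measurableT_comp _ _ _ _ _ _ _ _ (fun t : T => (t, [tuple] : 0.-tuple R)) mF.
  by apply; exact: measurable_fun_pair.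
have H : measurable_fun [set: T * measurableTypeR R]
    (fun p : T * measurableTypeR R => gexp sds (fun z => F p.1 (p.2 :: z))).
  apply: IH => [t z|]; first exact: F0.
  apply: (@measurableT_comp _ _ _ _ _ _ _ _
    (fun p : (T * measurableTypeR R) * (size sds).-tuple R =>
      (p.1.1, [the (size sds).+1.-tuple R of p.1.2 :: p.2])) mF).
  apply: measurable_fun_pair => /=.
    by apply: measurableT_comp => //.
  apply: measurable_cons => //.
  by apply: measurableT_comp.
have := @measurable_fun_fubini_tonelli_F _ _ T _ R (normal_prob 0 s) _ H.
apply.
by move=> p; apply: gexp_ge0 => z; exact: F0.
Qed.

Lemma seq_measurable_cons N f x :
  seq_measurable N.+1 f -> seq_measurable N (fun z => f (x :: z)).
Proof.
move=> mf; rewrite /seq_measurable.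
apply: (@measurableT_comp _ _ _ _ _ _ _ _
  (fun t : N.-tuple R => [the N.+1.-tuple R of x :: t]) mf).
exact: measurable_cons.
Qed.

Lemma measurable_gexp_cons sds f : (forall z, 0 <= f z)%E ->
  seq_measurable (size sds).+1 f ->
  measurable_fun [set: R] (fun x => gexp sds (fun z => f (x :: z))).
Proof.
move=> f0 mf; apply: (measurable_gexp (F := fun x z => f (x :: z))) => //.
apply: (@measurableT_comp _ _ _ _ _ _ _ _
  (fun p : R * (size sds).-tuple R =>
    [the (size sds).+1.-tuple R of p.1 :: p.2]) mf).
exact: measurable_cons.
Qed.

Lemma gexpD sds f g : (forall z, 0 <= f z)%E -> (forall z, 0 <= g z)%E ->
  seq_measurable (size sds) f -> seq_measurable (size sds) g ->
  (gexp sds (fun z => f z + g z) = gexp sds f + gexp sds g)%E.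
Proof.
elim: sds f g => //= s sds IH f g f0 g0 mf mg.
rewrite -ge0_integralD//; first last.
- exact: measurable_gexp_cons.
- by move=> x _; exact: gexp_ge0.
- exact: measurable_gexp_cons.
- by move=> x _; exact: gexp_ge0.
by apply: eq_integral => x _; rewrite IH//; exact: seq_measurable_cons.
Qed.

Lemma gexpZl sds (k : R) f : 0 <= k -> (forall z, 0 <= f z)%E ->
  seq_measurable (size sds) f ->
  (gexp sds (fun z => k%:E * f z) = k%:E * gexp sds f)%E.
Proof.
elim: sds f => //= s sds IH f k0 f0 mf.
rewrite -ge0_integralZl//; first last.
- by move=> x _; exact: gexp_ge0.
- exact: measurable_gexp_cons.
by apply: eq_integral => x _; rewrite IH//; exact: seq_measurable_cons.
Qed.

Lemma le_gexp sds f g : (forall z, 0 <= f z)%E ->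
  (forall z, size z = size sds -> (f z <= g z)%E) ->
  seq_measurable (size sds) f -> seq_measurable (size sds) g ->
  (gexp sds f <= gexp sds g)%E.
Proof.
elim: sds f g => /= [|s sds IH] f g f0 fg mf mg; first exact: fg.
(* Nothing is known of [g] on lists of other lengths, so its positive part replaces it; both agree
   on the lists that count. *)
have g'0 z : (0 <= maxe (g z) 0)%E by rewrite le_max lexx orbT.
have mg' : seq_measurable (size sds).+1 (fun z => maxe (g z) 0).
  exact: (measurable_maxe mg (measurable_cst _)).
have -> : (fun x => gexp sds (fun zs => g (x :: zs))) =
          (fun x => gexp sds (fun zs => maxe (g (x :: zs)) 0)).
  apply/funext => x; apply: eq_gexp => z sz; apply/esym/max_idPl.
  by apply: le_trans (fg (x :: z) _); rewrite ?f0//= sz.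
apply: ge0_le_integral => //.
- by move=> x _; exact: gexp_ge0.
- exact: measurable_gexp_cons.
- exact: (measurable_gexp_cons g'0).
- move=> x _; apply: IH => [//|z sz| |]; last exact: (seq_measurable_cons _ mg').
    by apply: le_trans (fg _ _) _; rewrite ?le_max ?lexx//= sz.
  exact: seq_measurable_cons.
Qed.

Lemma gexp_cst sds (c : R) : gexp sds (fun=> c%:E) = c%:E.
Proof.
elim: sds => //= s sds IH; under eq_integral do rewrite IH.
exact: integral_normal_cst.
Qed.

Lemma measurable_nth N i :
  measurable_fun [set: N.-tuple R] (fun t : N.-tuple R => t`_i).
Proof.
have [iN|Ni] := ltnP i N; last first.
  rewrite (_ : (fun _ => _) = cst 0)//; apply/funext => t /=.
  by rewrite nth_default// size_tuple.
rewrite (_ : (fun _ => _) = fun t => tnth t (Ordinal iN)); first exact: measurable_tnth.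
by apply/funext => t; rewrite (tnth_nth 0).
Qed.

Fixpoint shiftz (c : nat -> R) z : seq R :=
  if z is x :: z' then (x + c 0%N) :: shiftz (c \o succn) z' else [::].

Lemma size_shiftz c z : size (shiftz c z) = size z.
Proof. by elim: z c => //= x z IH c; rewrite IH. Qed.

Lemma nth_shiftz c z i : (i < size z)%N -> (shiftz c z)`_i = z`_i + c i.
Proof. by elim: z c i => // x z IH c [|i] //= iz; rewrite IH. Qed.

(** Logarithm of the likelihood ratio between the noise shifted by [c] and the noise itself. *)
Definition tilt (c : nat -> R) sds z : R :=
  \sum_(j < size sds) (c j * z`_j / sds`_j ^+ 2 - c j ^+ 2 / (sds`_j ^+ 2 *+ 2)).

Lemma measurable_tilt c sds N :
  measurable_fun [set: N.-tuple R] (fun t : N.-tuple R => tilt c sds t).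
Proof.
apply: measurable_sum => j; apply: measurable_funB => //.
apply: measurable_funM => //; apply: measurable_funM => //.
exact: measurable_nth.
Qed.

Lemma seq_measurable_tilt N c sds f : seq_measurable N f ->
  seq_measurable N (fun z => f z * (expR (tilt c sds z))%:E)%E.
Proof.
move=> mf; apply: emeasurable_funM => //; apply/measurable_EFinP.
by apply: measurableT_comp => //; exact: measurable_tilt.
Qed.

(* Cameron-Martin for a product of centred Gaussians. *)
Lemma gexp_shift c sds f : all (predC1 0) sds -> (forall z, 0 <= f z)%E ->
  seq_measurable (size sds) f ->
  gexp sds (fun z => f (shiftz c z)) =
  gexp sds (fun z => f z * (expR (tilt c sds z))%:E)%E.
Proof.
elim: sds c f => [|s sds IH] c f /=; first by rewrite /tilt big_ord0 expR0 mule1.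
move=> /andP[s0 sds0] f0 mf.
pose g (x : R) := gexp sds (fun z => f (x :: z) * (expR (tilt (c \o succn) sds z))%:E)%E.
have fe0 x z : (0 <= f (x :: z) * (expR (tilt (c \o succn) sds z))%:E)%E.
  by rewrite mule_ge0// lee_fin expR_ge0.
have me x : seq_measurable (size sds)
    (fun z => f (x :: z) * (expR (tilt (c \o succn) sds z))%:E)%E.
  by apply: seq_measurable_tilt; exact: seq_measurable_cons.
transitivity (\int[normal_prob 0 s]_x g (x + c 0%N)%R)%E.
  apply: eq_integral => x _.
  by apply: (IH (c \o succn) (fun z => f ((x + c 0%N)%R :: z))) => //;
    exact: seq_measurable_cons.
rewrite ge0_integral_normal_shift//; last 2 first.
- rewrite /g; apply: (measurable_gexp (F := fun x z => _)) => //.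
  apply: emeasurable_funM.
    apply: (@measurableT_comp _ _ _ _ _ _ _ _
      (fun p : R * (size sds).-tuple R =>
        [the (size sds).+1.-tuple R of p.1 :: p.2]) mf).
    exact: measurable_cons.
  apply/measurable_EFinP/measurableT_comp => //.
  apply: (@measurableT_comp _ _ _ _ _ _ (fun t : (size sds).-tuple R =>
    tilt (c \o succn) sds t) _ snd) => //.
  exact: measurable_tilt.
- by move=> x; exact: gexp_ge0.
apply: eq_integral => x _; rewrite muleC -gexpZl ?expR_ge0//.
apply: eq_gexp => z sz; rewrite muleCA -EFinM -expRD; congr (_ * (expR _)%:E)%E.
by rewrite /tilt/= big_ord_recl/=.
Qed.

Definition ev (c : nat -> R) z : R := \sum_(j < size z) c j * z`_j.

Lemma seq_measurable_ev N c : measurable_fun [set: N.-tuple R] (fun t => ev c t).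
Proof.
rewrite (_ : (fun _ => _) = fun t : N.-tuple R => \sum_(j < N) c j * t`_j).
  by apply: measurable_sum => j; apply: measurable_funM => //; exact: measurable_nth.
by apply/funext => t; rewrite /ev size_tuple.
Qed.

Lemma seq_measurable_affine_sqr N (b : R) c :
  seq_measurable N (fun z => ((b + ev c z) ^+ 2)%:E).
Proof.
apply/measurable_EFinP; apply: (@measurable_funX _ _ _ _ (fun t : N.-tuple R => b + ev c t)).
by apply: measurable_funD => //; exact: seq_measurable_ev.
Qed.

(** The inner expectation is bounded first, with the outer coordinate absorbed into [b]. *)
Lemma gexp_affine_sqr_ge sds (b : R) (c : nat -> R) : all (fun s => 0 < s) sds ->
  ((b ^+ 2 + \sum_(j < size sds) c j ^+ 2 * sds`_j ^+ 2)%:E <=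
    gexp sds (fun z => ((b + ev c z) ^+ 2)%:E))%E.
Proof.
elim: sds b c => [|s sds IH] b c /=; first by rewrite /ev !big_ord0 !addr0.
move=> /andP[s0 sds0]; rewrite big_ord_recl/= addrA.
set q := \sum_(j < _) _.
have q0 : 0 <= q by rewrite sumr_ge0// => j _; rewrite mulr_ge0// sqr_ge0.
apply: le_trans (normal_affine_moment_ge _ _ s0 q0) _.
have f0 x : (0 <= gexp sds (fun zs => ((b + ev c (x :: zs)) ^+ 2)%:E))%E.
  by apply: gexp_ge0 => z; rewrite lee_fin sqr_ge0.
apply: ge0_le_integral => //.
- by move=> x _; rewrite lee_fin addr_ge0// sqr_ge0.
- apply/measurable_EFinP/measurable_funD => //; apply: measurable_funX.
  by apply: measurable_funD => //; exact: measurable_funM.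
- apply: (measurable_gexp_cons (f := fun z => ((b + ev c z) ^+ 2)%:E)).
    by move=> z; rewrite lee_fin sqr_ge0.
  exact: seq_measurable_affine_sqr.
- move=> x _; apply: le_trans (IH (b + c 0%N * x) (c \o succn) sds0) _.
  rewrite le_eqVlt; apply/orP; left; apply/eqP/eq_gexp => z _.
  by rewrite /ev/= big_ord_recl/= addrA.
Qed.
End gexp.

(** * Decoding with a message point *)

(* Cells of width 1/W cover the points with |theta m| <= 2 sqrt v; by Markov's
   inequality at most a quarter of the points lie outside. *)
Lemma message_count_le (R : realType) (M : nat) (theta p : nat -> R)
    (q : nat -> R -> R) (W v e : R) :
  0 <= W -> 0 <= v -> 0 <= e ->
  \sum_(m < M) theta m ^+ 2 <= M%:R * v ->
  (forall m t, 0 <= q m t) -> (forall t, \sum_(m < M) q m t <= 1) ->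
  (forall m, p m <= 1) ->
  (forall m t, `|theta m - t| * W <= 1 -> p m <= e * q m t + 4^-1) ->
  3 / 4 * M%:R <= \sum_(m < M) p m ->
  M%:R <= 4 * e * (4 * Num.sqrt v * W + 1).
Proof.
move=> W0 v0 e0 th_v q0 q1 p1 pq pM; set A : R := 2 * Num.sqrt v.
have A0 : 0 <= A by rewrite mulr_ge0 ?sqrtr_ge0.
have A2 : A ^+ 2 = 4 * v by rewrite exprMn sqr_sqrtr//; ring.
set L := (Num.truncn (2 * A * W)).+1.
(* Left ends of the cells covering [[-A, A]]. If [W = 0] there is a single cell, and the closeness
   condition holds for every point. *)
pose t (c : nat) := c%:R / W - A.
pose bad m : R := ((A < `|theta m|)%R : nat)%:R.
have bad_le m : A ^+ 2 * bad m <= theta m ^+ 2.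
  rewrite /bad; case: ltP => Am; last by rewrite mulr0 sqr_ge0.
  by rewrite mulr1 -[leRHS]real_normK ?num_real// ler_sqr ?nnegrE// ltW.
have badM : \sum_(m < M) bad m <= M%:R / 4.
  have [v00|v_neq0] := eqVneq v 0; last first.
    have v_gt0 : 0 < 4 * v by rewrite mulr_gt0// lt0r v_neq0.
    rewrite -(ler_pM2l v_gt0) -A2 mulr_sumr.
    apply: (@le_trans _ _ (\sum_(m < M) theta m ^+ 2)).
      by apply: ler_sum => m _; exact: bad_le.
    by apply: le_trans th_v _; rewrite A2; lra.
  rewrite big1 ?divr_ge0// => m _.
  have : theta m ^+ 2 <= 0.
    move: th_v; rewrite v00 mulr0; apply: le_trans.
    by rewrite (bigD1 m)//= lerDl sumr_ge0// => i _; exact: sqr_ge0.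
  rewrite /bad ltNge => th0.
  have /eqP -> : theta m == 0 by rewrite -sqrf_eq0 eq_le th0 sqr_ge0.
  by rewrite normr0 A0.
have pm (m : 'I_M) : p m <= bad m + (e * \sum_(c < L) q m (t c) + 4^-1).
  have S0 : 0 <= e * \sum_(c < L) q m (t c) by rewrite mulr_ge0// sumr_ge0.
  rewrite /bad; case: ltP => [_|Am].
    by apply: le_trans (p1 m) _; rewrite lerDl addr_ge0// invr_ge0.
  rewrite add0r; set x := (theta m + A) * W.
  have tA : 0 <= theta m + A by move: Am; rewrite ler_norml => /andP[? _]; lra.
  have tA2 : theta m + A <= 2 * A by move: Am; rewrite ler_norml => /andP[_ ?]; lra.
  have x0 : 0 <= x by rewrite mulr_ge0.
  have cL : (Num.truncn x < L)%N by rewrite ltnS le_truncn// ler_wpM2r.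
  apply: le_trans (pq m (t (Num.truncn x)) _) _.
    have [W00|Wn0] := eqVneq W 0; first by rewrite W00 mulr0.
    rewrite -[X in _ * X](ger0_norm W0) -normrM.
    have -> : (theta m - t (Num.truncn x)) * W = x - (Num.truncn x)%:R.
      by rewrite /t /x; field.
    have := truncn_itv x0; rewrite ler_norml => /andP[H1 H2].
    move: H2; rewrite -natr1 => H2.
    by apply/andP; split; lra.
  rewrite lerD2r ler_wpM2l// (bigD1 (Ordinal cL))//= lerDl sumr_ge0// => c _.
(* One quarter is lost on the bad points and one on the slack in [pq]. At a cell end the decisions
   for different messages have total probability at most 1, so the [L] cells contribute at most
   [e * L]; against [3 / 4 * M] a quarter of [M] remains. *)
have : \sum_(m < M) p m <= M%:R / 4 + (e * L%:R + M%:R / 4).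
  apply: (@le_trans _ _ (\sum_(m < M) (bad m + (e * \sum_(c < L) q m (t c) + 4^-1)))).
    by apply: ler_sum => m _; exact: pm.
  rewrite !big_split/= sumr_const card_ord -[_ *+ M]mulr_natl.
  apply: lerD badM _; rewrite lerD2r -mulr_sumr ler_wpM2l// exchange_big/=.
  apply: (@le_trans _ _ (\sum_(c < L) 1)).
    by apply: ler_sum => c _; exact: q1.
  by rewrite sumr_const card_ord.
have : L%:R <= 2 * A * W + 1.
  by rewrite /L -natr1 lerD2r truncn_le !mulr_ge0.
rewrite /A => HL; have := ler_wpM2l e0 HL; lra.
Qed.

Section gexp_more.
Local Open Scope classical_set_scope.
Variable R : realType.
Implicit Types (sds z : seq R).

Lemma seq_measurable_sum N M (f : nat -> seq R -> \bar R) :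
  (forall m, seq_measurable N (f m)) ->
  seq_measurable N (fun z => \sum_(m < M) f m z)%E.
Proof. by move=> mf; apply: emeasurable_sum => m; exact: mf. Qed.

Lemma gexp_sum sds M (f : nat -> seq R -> \bar R) :
  (forall m z, 0 <= f m z)%E -> (forall m, seq_measurable (size sds) (f m)) ->
  (gexp sds (fun z => \sum_(m < M) f m z) = \sum_(m < M) gexp sds (f m))%E.
Proof.
move=> f0 mf; elim: M => [|M IH].
  rewrite big_ord0; transitivity (gexp sds (fun=> 0%:E)); last exact: gexp_cst.
  by apply: eq_gexp => z _; rewrite big_ord0.
rewrite big_ord_recr/= -IH -gexpD//.
- by apply: eq_gexp => z _; rewrite big_ord_recr.
- by move=> z; apply: sume_ge0.
- exact: seq_measurable_sum.
Qed.

(** The square of the likelihood ratio for [c] is a constant times the ratio for [2 c], which has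
    mean 1. *)
Lemma gexp_tilt_double sds (c : nat -> R) : all (fun s => 0 < s) sds ->
  gexp sds (fun z => (expR (tilt c sds z) ^+ 2)%:E) =
  (expR (\sum_(j < size sds) c j ^+ 2 / sds`_j ^+ 2))%:E.
Proof.
move=> sds0; set W2 := \sum_(j < _) _.
have sds_neq0 : all (predC1 0) sds.
  by apply: sub_all sds0 => s /= s0; rewrite gt_eqF.
have tE z : expR (tilt c sds z) ^+ 2 =
    expR W2 * expR (tilt (fun j => 2 * c j) sds z).
  rewrite -expRM_natl -expRD; congr expR; rewrite /W2 /tilt mulr_sumr -big_split/=.
  apply: eq_bigr => j _; field.
  by move/allP: sds_neq0 => /(_ sds`_j); apply; rewrite mem_nth.
transitivity (gexp sds (fun z =>
    ((expR W2)%:E * (cst 1 z * (expR (tilt (fun j => 2 * c j) sds z))%:E))))%E.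
  by apply: eq_gexp => z _; rewrite tE EFinM mul1e.
rewrite gexpZl ?expR_ge0//; last 2 first.
- by move=> z; rewrite mule_ge0// lee_fin expR_ge0.
- by apply: seq_measurable_tilt; exact: measurable_cst.
rewrite -gexp_shift//; last exact: measurable_cst.
by rewrite gexp_cst mule1.
Qed.

End gexp_more.

Section decoding.
Local Open Scope classical_set_scope.
Variables (R : realType) (sds : seq R) (n : nat).
Variables (y : nat -> nat -> R) (h c : nat -> R) (dec : n.-tuple R -> nat).
Hypothesis sds_gt0 : all (fun s => 0 < s) sds.
Hypothesis mdec : forall j, measurable (dec @^-1` [set j]).
Hypothesis ych : forall i, (i < n)%N -> \sum_(j < size sds) y i j * c j = h i.

(** The message point is any real number, since the cell ends in [message_count_le] need not be
    values of [theta]. *)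
Definition output (x : R) (z : seq R) : n.-tuple R :=
  [tuple h i * x + ev (y i) z | i < n].

Definition decoded (m : nat) (x : R) (z : seq R) : \bar R :=
  ((dec (output x z) == m)%:R)%:E.

Lemma decoded_ge0 m x z : (0 <= decoded m x z)%E.
Proof. by rewrite lee_fin. Qed.

Lemma seq_measurable_dec (P : pred nat) N x :
  (exists m, P =1 pred1 m \/ P =1 predC1 m) ->
  seq_measurable N (fun z => ((P (dec (output x z)))%:R)%:E).
Proof.
move=> [m Pm].
have mo : measurable_fun [set: N.-tuple R] (fun t : N.-tuple R => output x t).
  apply/measurable_fun_tnthP => i.
  rewrite (_ : _ \o _ = fun t : N.-tuple R => h i * x + ev (y i) t).
    by apply: measurable_funD => //; exact: seq_measurable_ev.
  by apply/funext => t /=; rewrite tnth_mktuple.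
have mA : measurable [set t : N.-tuple R | P (dec (output x t))].
  have mB := mo measurableT _ (mdec m); rewrite setTI in mB.
  case: Pm => Pm.
    rewrite (_ : [set _ | _] = (fun t : N.-tuple R => output x t) @^-1` (dec @^-1` [set m]))//.
    by apply/seteqP; split => t /=; rewrite Pm => /eqP.
  rewrite (_ : [set _ | _] = ~` ((fun t : N.-tuple R => output x t) @^-1` (dec @^-1` [set m]))).
    exact: measurableC.
  by apply/seteqP; split => t /=; rewrite Pm => /eqP.
rewrite /seq_measurable (_ : (fun _ => _) =
    EFin \o \1_[set t : N.-tuple R | P (dec (output x t))]).
  by apply/measurable_EFinP; exact: measurable_indic.
by apply/funext => t /=; rewrite indicE; congr ((nat_of_bool _)%:R)%:E; apply/idP/idP => [|/set_mem//] H; apply/mem_set.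
Qed.

Lemma seq_measurable_decoded N m x : seq_measurable N (decoded m x).
Proof. by apply: (@seq_measurable_dec (pred1 m)); exists m; left. Qed.

Lemma gexp_decoded_sum M x : (\sum_(m < M) gexp sds (decoded m x) <= 1)%E.
Proof.
rewrite -(gexp_sum M (f := decoded ^~ x)); last 2 first.
- by move=> m z; exact: decoded_ge0.
- by move=> m; exact: seq_measurable_decoded.
rewrite -(gexp_cst sds 1); apply: le_gexp.
- by move=> z; apply: sume_ge0 => m _; exact: decoded_ge0.
- move=> z _; rewrite sumEFin lee_fin -natr_sum.
  set d := dec _; rewrite -[leRHS]/(1%:R) ler_nat.
  have [dM|Md] := ltnP d M.
    rewrite (bigD1 (Ordinal dM))//= eqxx big1// => i.
    by rewrite -val_eqE/= eq_sym => /negbTE ->.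
  by rewrite big1// => i _; rewrite gtn_eqF// (leq_trans (ltn_ord i)).
- apply: (@seq_measurable_sum _ _ M (decoded ^~ x)) => m.
  exact: seq_measurable_decoded.
- exact: measurable_cst.
Qed.

(** By [ych], moving the message point by [d] amounts to shifting the noise by [d * c]. The
    likelihood ratio is unbounded, and the additive [1/4] pays for its tail through the second
    moment. *)
Lemma gexp_decoded_move m t d :
  d ^+ 2 * \sum_(j < size sds) c j ^+ 2 / sds`_j ^+ 2 <= 1 ->
  (gexp sds (decoded m (t + d)) <= (expR 1)%:E * gexp sds (decoded m t) + 4^-1%:E)%E.
Proof.
move=> dW; set W2 := \sum_(j < _) _ in dW.
pose dc j := d * c j.
have f0 z : (0 <= decoded m t z)%E by exact: decoded_ge0.
have mf : seq_measurable (size sds) (decoded m t) by exact: seq_measurable_decoded.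
have outE z : size z = size sds -> output (t + d) z = output t (shiftz dc z).
  move=> sz; apply: eq_from_tnth => i; rewrite !tnth_mktuple -(ych (ltn_ord i)).
  rewrite /ev size_shiftz sz mulrDr -addrA; congr (_ + _).
  rewrite addrC mulr_suml -big_split/=; apply: eq_bigr => j _.
  by rewrite nth_shiftz ?sz// /dc; ring.
rewrite (eq_gexp (g := fun z => decoded m t (shiftz dc z))); last first.
  by move=> z sz; rewrite /decoded outE.
rewrite gexp_shift//; last by apply: sub_all sds_gt0 => s /= s0; rewrite gt_eqF.
have e1 : 0 < 4 * expR 1 :> R by rewrite mulr_gt0// expR_gt0.
(* The second moment of the likelihood ratio is at most [expR 1], so [k] times it is at most
   [1/4]. *)
pose k : R := (4 * expR 1)^-1.
have k0 : 0 <= k by rewrite invr_ge0 ltW.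
have mE : seq_measurable (size sds) (fun z => (expR (tilt dc sds z) ^+ 2)%:E).
  apply/measurable_EFinP.
  apply: (@measurable_funX _ _ _ _ (fun t : (size sds).-tuple R => expR (tilt dc sds t))).
  by apply: measurableT_comp => //; exact: measurable_tilt.
(* E <= e + E^2 / (4 e) for the likelihood ratio E *)
apply: (@le_trans _ _ (gexp sds (fun z => (expR 1)%:E * decoded m t z +
    k%:E * (expR (tilt dc sds z) ^+ 2)%:E))%E).
  apply: le_gexp.
  - by move=> z; rewrite mule_ge0// lee_fin expR_ge0.
  - move=> z _; rewrite /decoded -!EFinM -EFinD lee_fin.
    set b : R := (_ == _)%:R; set E := expR (tilt _ _ _).
    have kE : k * (4 * expR 1) = 1 by rewrite mulVf// gt_eqF.
    have b01 : b = 0 \/ b = 1 by rewrite /b; case: (_ == _); [right|left].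
    case: b01 => ->; first by rewrite mul0r mulr0 add0r mulr_ge0 ?sqr_ge0.
    rewrite mul1r mulr1 -subr_ge0.
    rewrite (_ : _ - E = k * (E - 2 * expR 1) ^+ 2); last first.
      by rewrite /k; field; rewrite gt_eqF ?expR_gt0.
    by rewrite mulr_ge0// sqr_ge0.
  - exact: seq_measurable_tilt.
  - by apply: emeasurable_funD; exact: measurable_funeM.
rewrite gexpD; last 4 first.
- by move=> z; rewrite mule_ge0// lee_fin expR_ge0.
- by move=> z; rewrite -EFinM lee_fin mulr_ge0// sqr_ge0.
- exact: measurable_funeM.
- exact: measurable_funeM.
rewrite gexpZl ?expR_ge0// gexpZl//.
rewrite leeD2l// gexp_tilt_double// -EFinM lee_fin.
rewrite (_ : \sum_(j < _) _ = d ^+ 2 * W2); last first.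
  by rewrite mulr_sumr; apply: eq_bigr => j _; rewrite exprMn mulrA.
have : expR (d ^+ 2 * W2) <= expR 1 by rewrite ler_expR.
move=> H; apply: le_trans (ler_wpM2l k0 H) _.
by rewrite /k invfM -mulrA mulVf ?mulr1// gt_eqF// expR_gt0.
Qed.

Lemma decoding_bound M (theta : nat -> R) (v : R) : 0 <= v ->
  \sum_(m < M) theta m ^+ 2 <= M%:R * v ->
  (\sum_(m < M) gexp sds (fun z => ((dec (output (theta m) z) != m)%:R)%:E)
    <= (M%:R / 4)%:E)%E ->
  M%:R <= 4 * expR 1 * (4 * Num.sqrt v *
    Num.sqrt (\sum_(j < size sds) c j ^+ 2 / sds`_j ^+ 2) + 1).
Proof.
move=> v0 th_v err; set W2 := \sum_(j < _) _.
have W20 : 0 <= W2 by rewrite sumr_ge0// => j _; rewrite divr_ge0// sqr_ge0.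
have G0 m x : (0 <= gexp sds (decoded m x))%E.
  by apply: gexp_ge0 => z; exact: decoded_ge0.
have G1 m x : (gexp sds (decoded m x) <= 1)%E.
  apply: le_trans (gexp_decoded_sum m.+1 x).
  by rewrite big_ord_recr/= leeDr// sume_ge0.
have Gfin m x : gexp sds (decoded m x) \is a fin_num.
  by rewrite ge0_fin_numE// (le_lt_trans (G1 m x))// ltry.
pose q m x := fine (gexp sds (decoded m x)).
have qE m x : gexp sds (decoded m x) = (q m x)%:E by rewrite fineK.
apply: (@message_count_le R M theta (fun m => q m (theta m)) q) => //.
- by move=> m x; rewrite -lee_fin -qE.
- move=> x; rewrite -lee_fin -sumEFin.
  by under eq_bigr do rewrite -qE; exact: gexp_decoded_sum.
- by move=> m; rewrite -lee_fin -qE.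
- move=> m x xW; have : (theta m - x) ^+ 2 * W2 <= 1.
    rewrite -[W2]sqr_sqrtr// -exprMn -real_normK ?num_real// normrM.
    rewrite (ger0_norm (sqrtr_ge0 _)) exprn_ile1// mulr_ge0// sqrtr_ge0.
  move=> /(gexp_decoded_move m x); rewrite addrC subrK !qE.
  by rewrite -EFinM -EFinD lee_fin.
- have compl m x : (gexp sds (fun z => ((dec (output x z) != m)%:R)%:E) =
      (1 - q m x)%:E)%E.
    have : (gexp sds (decoded m x) +
        gexp sds (fun z => ((dec (output x z) != m)%:R)%:E) = 1)%E.
      rewrite -gexpD; last 4 first.
      + by move=> z; exact: decoded_ge0.
      + by move=> z; rewrite lee_fin.
      + exact: seq_measurable_decoded.
      + by apply: (@seq_measurable_dec (predC1 m)); exists m; right.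
      rewrite -(gexp_cst sds 1); apply: eq_gexp => z _.
      by rewrite /decoded; case: (_ == _); rewrite /= ?adde0 ?add0e.
    rewrite qE; case: (gexp _ _) => [r||]//= [<-].
    by rewrite addrAC subrr add0r.
  move: err; under eq_bigr do rewrite compl.
  rewrite sumEFin lee_fin big_split/= sumr_const card_ord sumrN -[_ *+ M]mulr_natl.
  lra.
Qed.

End decoding.

(** * From determinants to rates *)

Lemma ln_le_subr1 (R : realType) (x : R) : 0 < x -> ln x <= x - 1.
Proof.
move=> x0; have := @le_ln1Dx R (x - 1); rewrite [1 + _]addrC subrK; apply.
by rewrite ltrBrDr addNr.
Qed.

(** Concavity of [ln] between 1 and [y]: the tangent bounds at [y / z] and [1 / z], with weights [t]
    and [1 - t], cancel. *)
Lemma ln_convex_comb_ge (R : realType) (t y : R) : 0 <= t <= 1 -> 0 < y ->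
  t * ln y <= ln (1 + t * (y - 1)).
Proof.
move=> /andP[t0 t1] y0; set z := 1 + _.
have z0 : 0 < z.
  have zE : z = (1 - t) + t * y by rewrite /z; ring.
  have [t00|tn0] := eqVneq t 0; first by rewrite zE t00 mul0r; lra.
  by rewrite zE ltr_wpDl ?subr_ge0// mulr_gt0// lt0r tn0.
have zi : 0 < z^-1 by rewrite invr_gt0.
have h1 : ln y - ln z <= y / z - 1.
  by rewrite -ln_div ?posrE//; apply: ln_le_subr1; exact: divr_gt0.
have h2 : - ln z <= z^-1 - 1 by rewrite -lnV ?posrE//; exact: ln_le_subr1.
have t1' : 0 <= 1 - t by rewrite subr_ge0.
have := ler_wpM2l t0 h1; have := ler_wpM2l t1' h2.
have : t * (y / z) + (1 - t) / z = 1.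
  by rewrite /z; field; rewrite -/z gt_eqF.
by move: (y / z) (z^-1) (ln y) (ln z) => a b c d; lra.
Qed.

Section RateChain.
Variables (R : realType) (K n : nat) (P X D : R).
Variables (N p : nat -> R) (V : nat -> nat -> R).
Hypotheses (K_gt0 : (0 < K)%N) (X_gt0 : 0 < X).
Hypothesis N_gt0 : forall k, (1 <= k <= K)%N -> 0 < N k.
Hypothesis N_decr : forall k, (1 <= k < K)%N -> N k.+1 <= N k.
Hypothesis p_ge0 : forall k, (k <= K)%N -> 0 <= p k.
Hypotheses (p0 : p 0%N = P) (pK : p K = 0).
Hypothesis pX : forall k, (1 <= k <= K)%N -> p k.-1 + N k = X * (p k + N k).
Hypothesis V_ge0 : forall k i, 0 <= V k i.
Hypothesis V0 : \sum_(i < n) V 0%N i <= n%:R * P.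
Hypothesis VD : forall k, (1 <= k <= K)%N ->
  D * \prod_(i < n) (V k i + N k) <= \prod_(i < n) (V k.-1 i + N k).

(** Compares a product from [VD] with its value for the constant profile [V q i = r]. *)
Let lnratio k q r := \sum_(i < n) ln ((V q i + N k) / (r + N k)).

Let lnratioE k q (r : R) : (1 <= k <= K)%N -> 0 <= r ->
  lnratio k q r = ln (\prod_(i < n) (V q i + N k)) - n%:R * ln (r + N k).
Proof.
move=> kK r0; have Nk := N_gt0 kK.
have rN : 0 < r + N k by rewrite ltr_wpDl.
have VN i : 0 < V q i + N k by rewrite ltr_wpDl.
rewrite /lnratio mulr_natl -lnXn// -ln_div ?posrE ?exprn_gt0//; last first.
  by apply: prodr_gt0 => i _.
have -> : (r + N k) ^+ n = \prod_(i < n) (r + N k) by rewrite prodr_const card_ord.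
rewrite -prodf_div.
elim: (index_enum _) => [|i s IH]; first by rewrite !big_nil ln1.
rewrite !big_cons IH [RHS]lnM ?posrE ?divr_gt0//.
by apply: prodr_gt0 => j _; rewrite divr_gt0.
Qed.

(* If X^n < D, then [lnratio k.+1 k (p k) <= 0] propagates from k to k.+1 (Jensen
   at the tangent point p), and at k = K it contradicts V >= 0 = p K. *)
Lemma chain_bound : D <= X ^+ n.
Proof.
rewrite leNgt; apply/negP => XD.
have Xn : 0 < X ^+ n by rewrite exprn_gt0.
have D0 : 0 < D by apply: lt_trans XD.
(* From [k.-1] to [k] the constant profiles [p] lose exactly [n * ln X], while [VD] makes the actual
   variances lose at least [ln D], which is more. *)
have gap k : (1 <= k <= K)%N -> lnratio k k (p k) < lnratio k k.-1 (p k.-1).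
  move=> kK; have Nk := N_gt0 kK.
  have pk : 0 <= p k by apply: p_ge0; lia.
  have pk1 : 0 <= p k.-1 by apply: p_ge0; lia.
  have VN q : 0 < \prod_(i < n) (V q i + N k).
    by apply: prodr_gt0 => i _; rewrite ltr_wpDl.
  have lnp : ln (p k.-1 + N k) = ln X + ln (p k + N k).
    by rewrite pX// lnM ?posrE// ltr_wpDl.
  rewrite !lnratioE// lnp mulrDr.
  have : ln D + ln (\prod_(i < n) (V k i + N k)) <= ln (\prod_(i < n) (V k.-1 i + N k)).
    rewrite -lnM ?posrE// ler_ln ?posrE//; first exact: VD.
    exact: mulr_gt0.
  have : n%:R * ln X < ln D by rewrite mulr_natl -lnXn// ltr_ln ?posrE.
  lra.
have A_le0 k : (k < K)%N -> lnratio k.+1 k (p k) <= 0.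
  elim: k => [|k IH] kK.
    (* Base case: the tangent bound of [ln] at 1 turns the power constraint into the claim. *)
    have N1 := N_gt0 (k := 1%N) K_gt0.
    have P0 : 0 <= P by rewrite -p0; exact: p_ge0.
    have PN : 0 < P + N 1%N by rewrite ltr_wpDl.
    rewrite p0; apply: (@le_trans _ _ (\sum_(i < n) ((V 0%N i - P) / (P + N 1%N)))).
      apply: ler_sum => i _.
      have -> : (V 0%N i - P) / (P + N 1%N) = (V 0%N i + N 1%N) / (P + N 1%N) - 1.
        by field; rewrite gt_eqF.
      by apply: ln_le_subr1; rewrite divr_gt0// ltr_wpDl.
    rewrite -mulr_suml pmulr_lle0 ?invr_gt0// sumrB sumr_const card_ord.
    by rewrite subr_le0 -[_ *+ n]mulr_natl.
  have kK1 : (1 <= k.+1 <= K)%N by lia.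
  have B0 : lnratio k.+1 k.+1 (p k.+1) <= 0.
    by apply: le_trans (ltW (gap _ kK1)) _; apply: IH; lia.
  have N1 := N_gt0 kK1; have N2 := N_gt0 (k := k.+2) kK.
  have N12 : N k.+2 <= N k.+1 by apply: N_decr; lia.
  have pk : 0 <= p k.+1 by apply: p_ge0; lia.
  (* Change of noise at a fixed level: [(V + N k.+1) / a] is the average of [(V + N k.+2) / b] and 1
     with weights [b / a] and [1 - b / a]. The weights are admissible because [N] decreases, so
     concavity carries the sign over. *)
  set a := p k.+1 + N k.+1; set b := p k.+1 + N k.+2.
  have a0 : 0 < a by rewrite ltr_wpDl.
  have b0 : 0 < b by rewrite ltr_wpDl.
  have ab : 0 <= b / a <= 1.
    apply/andP; split; first by apply/ltW; exact: divr_gt0.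
    by rewrite ler_pdivrMr// mul1r lerD2l.
  have ba : 0 < b / a by rewrite divr_gt0.
  rewrite -(pmulr_rle0 _ ba); apply: le_trans B0.
  rewrite /lnratio mulr_sumr; apply: ler_sum => i _.
  have y0 : 0 < (V k.+1 i + N k.+2) / b by rewrite divr_gt0// ltr_wpDl.
  apply: le_trans (ln_convex_comb_ge ab y0) _.
  rewrite le_eqVlt; apply/orP; left; apply/eqP; congr ln.
  by rewrite -/a /a /b; field; rewrite !gt_eqF.
have KK : (1 <= K <= K)%N by rewrite K_gt0 leqnn.
have NK := N_gt0 KK.
have := gap K KK; apply/negP; rewrite -leNgt.
apply: (@le_trans _ _ 0).
  by have := A_le0 K.-1; rewrite prednK//; apply.
rewrite pK; apply: sumr_ge0 => i _; apply: ln_ge0.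
by rewrite add0r ler_pdivlMr ?mul1r ?lerDr.
Qed.

End RateChain.

(** * Existence of a power allocation with equal rates *)

Section E.
Variable (R : realType).
Variables (K : nat) (N : nat -> R).
Hypothesis N_gt0 : forall k, (1 <= k <= K)%N -> 0 < N k.

(* p_K = 0 and p_(k-1) = x p_k + (x - 1) N_k, indexed by the distance to K *)
Fixpoint tailpow (d : nat) : {poly R} :=
  if d is d'.+1 then 'X * tailpow d' + ('X - 1) * (N (K - d'))%:P else 0.

Lemma tailpow1 d : (tailpow d).[1] = 0.
Proof. by elim: d => [|d IH]; rewrite /= !hornerE ?IH//; ring. Qed.

Lemma tailpow_ge0 d x : (d <= K)%N -> 1 <= x -> 0 <= (tailpow d).[x].
Proof.
move=> + x1; elim: d => [|d IH] dK; first by rewrite horner0.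
rewrite /= !hornerE; have := IH (ltnW dK).
have := N_gt0 (k := (K - d)%N) ltac:(lia).
by move: (N _) (horner _ _) => a b; nra.
Qed.

Lemma tailpow_decr d x : (d < K)%N -> 1 < x ->
  (tailpow d).[x] < (tailpow d.+1).[x].
Proof.
move=> dK x1; rewrite /= !hornerE; have := tailpow_ge0 (ltnW dK) (ltW x1).
have := N_gt0 (k := (K - d)%N) ltac:(lia).
by move: (N _) (horner _ _) => a b; nra.
Qed.

(** The common factor [x], the exponential of twice the rate, is the only unknown: it determines all
    powers backwards from [p K = 0]. Then [p 0 = P] is a polynomial equation in [x], solved by the
    intermediate value theorem. *)
Lemma exists_powers (P : R) : 0 < P -> (0 < K)%N ->
  exists (x : R) (p : nat -> R), [/\ 1 < x, p 0%N = P, p K = 0,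
    forall k, (1 <= k <= K)%N -> p k < p k.-1 &
    forall k, (1 <= k <= K)%N -> p k.-1 + N k = x * (p k + N k)].
Proof.
move=> P0 K0; set b := 1 + P / N 1%N.
have N1 : 0 < N 1%N by apply: N_gt0; lia.
have b1 : 1 < b by rewrite ltrDl divr_gt0.
have Pb : P <= (tailpow K).[b].
  have H := @tailpow_ge0 K.-1 b.
  rewrite -(prednK K0) /= !hornerE (_ : K - K.-1 = 1)%N; last by lia.
  have -> : (b - 1) * N 1%N = P by rewrite /b addrAC subrr add0r divfK ?gt_eqF.
  by rewrite lerDr mulr_ge0 ?H ?ltW ?leq_pred// (lt_trans ltr01).
have [|x /andP[x1 _] rx] := @poly_ivt _ (tailpow K - P%:P) _ _ (ltW b1).
  by rewrite !hornerE tailpow1 sub0r oppr_le0 subr_ge0 Pb ltW.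
have xP : (tailpow K).[x] = P.
  by move: rx; rewrite /root !hornerE subr_eq0 => /eqP.
have {}x1 : 1 < x.
  rewrite lt_neqAle x1 andbT; apply/eqP => x1'.
  by move: xP P0; rewrite -x1' tailpow1 => <-; rewrite ltxx.
exists x, (fun k => (tailpow (K - k)).[x]); split => //.
- by rewrite subn0.
- by rewrite subnn horner0.
- move=> k /andP[k1 kK]; have -> : (K - k.-1 = (K - k).+1)%N by lia.
  by apply: tailpow_decr => //; lia.
- move=> k /andP[k1 kK]; have -> : (K - k.-1 = (K - k).+1)%N by lia.
  by rewrite /= !hornerE subKn//; ring.
Qed.
End E.

Lemma Nk_gt0 (R : realType) (K : nat) (s2 : nat -> R) k :
  (forall k, (1 <= k <= K)%N -> 0 < s2 k) -> (1 <= k <= K)%N -> 0 < Nk s2 k.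
Proof.
move=> s20 kK; rewrite /Nk invr_gt0 big_nat_recl//; last by lia.
rewrite ltr_wpDr// ?invr_gt0 ?s20//; last by lia.
rewrite big_nat_cond sumr_ge0// => i iK.
by rewrite invr_ge0 ltW// s20//; lia.
Qed.

Lemma exists_alpha_star (R : realType) (K : nat) (P : R) (s2 : nat -> R) :
  (2 <= K)%N -> 0 < P -> (forall k, (1 <= k <= K)%N -> 0 < s2 k) ->
  exists alpha, alpha_star K s2 P alpha.
Proof.
move=> K2 P0 s20.
have NP k : (1 <= k <= K)%N -> 0 < Nk s2 k by exact: Nk_gt0.
have [|x [p [x1 p0 pK plt pE]]] := exists_powers NP P0; first by lia.
pose alpha k := (p k.-1 - p k) / P.
have sumE k : \sum_(1 <= i < k.+1) alpha i = (P - p k) / P.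
  elim: k => [|k IH]; first by rewrite big_geq// p0 subrr mul0r.
  by rewrite big_nat_recr//= IH /alpha -mulrDl; congr (_ / _); ring.
have alpha0 k : (1 <= k <= K)%N -> 0 < alpha k.
  by move=> kK; rewrite divr_gt0// subr_gt0 plt.
have sum1 : \sum_(1 <= i < K.+1) alpha i = 1.
  by rewrite sumE pK subr0 divff ?gt_eqF.
have pdecr i j : (i < j <= K)%N -> p j < p i.
  elim: j => // j IH /andP[]; rewrite ltnS leq_eqVlt => /orP[/eqP->|ij] jK.
    exact: (plt j.+1).
  by apply: lt_trans (IH _); [exact: (plt j.+1)|rewrite ij ltnW].
have pge0 k : (k <= K)%N -> 0 <= p k.
  by rewrite leq_eqVlt -pK => /orP[/eqP->//|kK]; rewrite ltW// pdecr// kK leqnn.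
have rateE k : (1 <= k <= K)%N ->
    1 + alpha k * P / ((1 - \sum_(1 <= i < k.+1) alpha i) * P + Nk s2 k) = x.
  move=> kK; have pk : 0 <= p k by apply: pge0; lia.
  have nz : p k + Nk s2 k != 0 by rewrite gt_eqF// ltr_wpDl// NP.
  rewrite sumE /alpha divfK ?gt_eqF//.
  have -> : (1 - (P - p k) / P) * P = p k by field; rewrite gt_eqF.
  by apply: (mulIf nz); rewrite -pE// mulrDl mul1r divfK//; ring.
exists alpha; split => //.
  move=> k kK; rewrite alpha0//= ltr_pdivrMr// mul1r.
  have [->|k1] := eqVneq k 1%N.
    by rewrite /= p0 gtrBl (le_lt_trans (pge0 2%N K2))// pdecr.
  rewrite -p0; have := pge0 k ltac:(lia); have := pdecr 0%N k.-1 ltac:(lia).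
  by lra.
move=> k kK; rewrite /= rateE; last lia.
have := rateE 1%N ltac:(lia); rewrite /rate1 big_nat1 => E.
congr (_ * ln _); rewrite -E; congr (1 + _ / (_ + _)).
by rewrite /Nk big_nat1 invrK.
Qed.

(** * Linear-feedback schemes *)

Section Inputs.
Variable R : realType.
Variables (K : nat) (a : nat -> R) (b : nat -> nat -> nat -> R).

Lemma size_inputs th z i : size (inputs K a b th z i) = i.
Proof. by elim: i => //= i IH; rewrite size_rcons IH. Qed.

Lemma nth_inputs th z i i' : (i < i')%N ->
  nth 0 (inputs K a b th z i') i = a i * th +
    \sum_(j < i) \sum_(k < K) b i j k.+1 *
      (nth 0 (inputs K a b th z i) j + Znoise K z k.+1 j).
Proof.
elim: i' => //= i' IH; rewrite ltnS leq_eqVlt => /orP[/eqP->|ii'].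
  by rewrite nth_rcons size_inputs ltnn eqxx.
by rewrite nth_rcons size_inputs ii' IH.
Qed.

Lemma nth_inputs_stable th z i i' j : (j < i)%N -> (j < i')%N ->
  nth 0 (inputs K a b th z i) j = nth 0 (inputs K a b th z i') j.
Proof. by move=> ji ji'; rewrite (nth_inputs th z ji) (nth_inputs th z ji'). Qed.

End Inputs.

(** * Linear functionals of the noise and their covariance *)

Section NoiseSpace.
Variable R : realType.
Variables (K n : nat) (s2 : nat -> R).
Hypothesis s2_gt0 : forall m, (1 <= m <= K)%N -> 0 < s2 m.

Local Notation noise := 'rV[R]_(n * K).
Local Notation sds := (noise_sds K n s2).

Lemma size_sds : size sds = (n * K)%N.
Proof. by rewrite size_map size_iota. Qed.

Lemma nth_sds j : (j < n * K)%N -> sds`_j ^+ 2 = s2 (j %% K).+1.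
Proof.
move=> jN; rewrite (nth_map 0%N) ?size_iota// nth_iota// add0n sqr_sqrtr//.
by apply/ltW/s2_gt0; rewrite ltn_mod; lia.
Qed.

Lemma sds_sqr_gt0 j : (j < n * K)%N -> 0 < sds`_j ^+ 2.
Proof. by move=> jN; rewrite nth_sds// s2_gt0// ltn_mod; lia. Qed.

Lemma sds_gt0 : all (fun s => 0 < s) sds.
Proof.
apply/allP => s /mapP[j]; rewrite mem_iota => /andP[_ jN] ->.
by rewrite sqrtr_gt0 s2_gt0// ltn_mod; lia.
Qed.

(* The covariance of the noise functionals [lin u] and [lin v]. *)
Definition ndot (u v : noise) : R := \sum_j u 0 j * v 0 j * sds`_j ^+ 2.

Lemma ndotC u v : ndot u v = ndot v u.
Proof. by apply: eq_bigr => j _; rewrite (mulrC (u 0 j)). Qed.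

Lemma ndotDl u v w : ndot (u + v) w = ndot u w + ndot v w.
Proof. by rewrite -big_split; apply: eq_bigr => j _; rewrite /= mxE !mulrDl. Qed.

Lemma ndotZl c u w : ndot (c *: u) w = c * ndot u w.
Proof. by rewrite mulr_sumr; apply: eq_bigr => j _; rewrite mxE !mulrA. Qed.

Lemma ndot_ge0 u : 0 <= ndot u u.
Proof. by apply: sumr_ge0 => j _; rewrite mulr_ge0 ?sqr_ge0// -expr2 sqr_ge0. Qed.

Lemma ndot_eq0 u : ndot u u = 0 -> u = 0.
Proof.
move=> u0; apply/rowP => j; rewrite mxE.
have T0 (i : 'I_(n * K)) : true -> 0 <= u 0 i * u 0 i * sds`_i ^+ 2.
  by rewrite mulr_ge0 ?sqr_ge0// -expr2 sqr_ge0.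
have /eqP : u 0 j * u 0 j * sds`_j ^+ 2 = 0 by exact: (psumr_eq0P T0 u0).
by rewrite mulf_eq0 (gt_eqF (sds_sqr_gt0 (ltn_ord j))) orbF mulf_eq0 orbb => /eqP.
Qed.

Definition coef (u : noise) (j : nat) : R := oapp (u 0) 0 (insub j).

Lemma coefE u (j : 'I_(n * K)) : coef u j = u 0 j.
Proof. by rewrite /coef valK. Qed.

Definition lin (u : noise) (z : seq R) : R := \sum_j u 0 j * z`_j.

Lemma evE u z : size z = (n * K)%N -> ev (coef u) z = lin u z.
Proof. by rewrite /ev => ->; apply: eq_bigr => j _; rewrite coefE. Qed.

Lemma linD u v z : lin (u + v) z = lin u z + lin v z.
Proof. by rewrite -big_split; apply: eq_bigr => j _; rewrite /= mxE mulrDl. Qed.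

Lemma linZ c u z : lin (c *: u) z = c * lin u z.
Proof. by rewrite mulr_sumr; apply: eq_bigr => j _; rewrite mxE mulrA. Qed.

Lemma lin_sum I (r : seq I) (F : I -> noise) z :
  lin (\sum_(i <- r) F i) z = \sum_(i <- r) lin (F i) z.
Proof.
elim: r => [|i r IH]; last by rewrite !big_cons linD IH.
by rewrite !big_nil /lin big1// => j _; rewrite mxE mul0r.
Qed.

Definition unoise (m i : nat) : noise := \row_j ((j == i * K + m.-1 :> nat)%N%:R).

Lemma unoise_index m i : (1 <= m <= K)%N -> (i < n)%N -> (i * K + m.-1 < n * K)%N.
Proof. by move=> mK i_n; nia. Qed.

Lemma sum_unoise m i (f : 'I_(n * K) -> R) (mK : (1 <= m <= K)%N) (i_n : (i < n)%N) :
  \sum_j unoise m i 0 j * f j = f (Ordinal (unoise_index mK i_n)).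
Proof.
rewrite (bigD1 (Ordinal (unoise_index mK i_n)))//= mxE eqxx mul1r big1 ?addr0// => j.
by rewrite -val_eqE/= mxE => /negbTE->; rewrite mul0r.
Qed.

Lemma lin_unoise m i z : (1 <= m <= K)%N -> (i < n)%N ->
  lin (unoise m i) z = Znoise K z m i.
Proof. by move=> mK i_n; rewrite /lin sum_unoise. Qed.

Lemma ndot_unoise m i m' i' : (1 <= m <= K)%N -> (1 <= m' <= K)%N ->
  (i < n)%N -> (i' < n)%N ->
  ndot (unoise m i) (unoise m' i') = if (m == m') && (i == i') then s2 m else 0.
Proof.
move=> mK m'K i_n i'_n; rewrite /ndot.
under eq_bigr do rewrite -mulrA.
rewrite (sum_unoise _ mK i_n) mxE/= nth_sds ?unoise_index//.
rewrite modnMDl modn_small; last by lia.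
rewrite prednK; last by lia.
have -> : (i * K + m.-1 == i' * K + m'.-1)%N = (m == m') && (i == i').
  apply/eqP/andP => [E|[/eqP-> /eqP->]//].
  have ii : i = i'.
    have := congr1 (divn^~ K) E; rewrite !divnMDl; try by lia.
    by rewrite !divn_small ?addn0//; lia.
  by split; apply/eqP => //; move: E; rewrite ii => /addnI; lia.
by case: ifP; rewrite ?mul1r ?mul0r.
Qed.

(** Strong induction on time. Noises of time [i] occupy the positions from [i * K] on, so causality
    is carried as vanishing of the coefficients there; the orthogonality to present and future
    noises follows. *)
Lemma inputs_linear (a : nat -> R) (b : nat -> nat -> nat -> R) :
  exists (h : nat -> R) (x : nat -> noise),
    (forall i j, (1 <= j <= K)%N -> forall i', (i <= i' < n)%N ->
       ndot (unoise j i') (x i) = 0) /\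
    (forall i th z, (i < n)%N ->
       nth 0 (inputs K a b th z n) i = h i * th + lin (x i) z).
Proof.
pose ok i (p : R * noise) := (forall j : 'I_(n * K), (i * K <= j)%N -> p.2 0 j = 0) /\
  forall th z, nth 0 (inputs K a b th z n) i = p.1 * th + lin p.2 z.
have ex i : (i < n)%N -> exists p, ok i p.
  elim/ltn_ind: i => i IH i_n.
  have /choice[f fok] : forall j : 'I_i, exists p, ok j p.
    by move=> j; apply: IH => //; exact: ltn_trans i_n.
  exists (a i + \sum_(j < i) \sum_(k < K) b i j k.+1 * (f j).1,
          \sum_(j < i) \sum_(k < K) b i j k.+1 *: ((f j).2 + unoise k.+1 j)).
  split=> [l il|th z] /=.
    rewrite summxE big1// => j _; rewrite summxE big1// => k _.
    have ji := ltn_ord j; have kK := ltn_ord k.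
    rewrite !mxE (fok j).1; last by nia.
    by rewrite gtn_eqF ?addr0 ?mulr0//; nia.
  rewrite (nth_inputs _ _ _ _ _ i_n) mulrDl -addrA; congr (_ + _).
  rewrite lin_sum mulr_suml -big_split; apply: eq_bigr => j _ /=.
  rewrite lin_sum mulr_suml -big_split; apply: eq_bigr => k _ /=.
  have jn : (j < n)%N by apply: ltn_trans i_n.
  rewrite linZ linD lin_unoise//; last by rewrite /= ltn_ord.
  rewrite (nth_inputs_stable _ _ _ _ _ (ltn_ord j) jn) (fok j).2.
  by ring.
have /choice[f fok] : forall i, exists p, (i < n)%N -> ok i p.
  move=> i; case: (ltnP i n) => [/ex[p pok]|_]; last by exists (0, 0).
  by exists p.
exists (fun i => (f i).1), (fun i => (f i).2); split.
  move=> i j jK i' /andP[ii' i'n]; rewrite /ndot.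
  under eq_bigr do rewrite -mulrA.
  rewrite (sum_unoise _ jK i'n) (fok i (leq_ltn_trans ii' i'n)).1 ?mul0r//=.
  by nia.
by move=> i th z i_n; rewrite (fok i i_n).2.
Qed.

End NoiseSpace.

(** * What power and reliability impose on one scheme *)

Section Scheme.
Local Open Scope classical_set_scope.
Variable R : realType.
Variables (K n M : nat) (s2 : nat -> R) (P : R) (S : lin_scheme R n).
Hypothesis s2_gt0 : forall m, (1 <= m <= K)%N -> 0 < s2 m.
Hypotheses (n_gt0 : (0 < n)%N) (M_gt0 : (0 < M)%N).
Hypothesis mdec : dec_measurable K S.
Hypothesis energy : (sch_energy K s2 M S <= (n%:R * P)%:E)%E.
Hypothesis perr : (sch_perr K s2 M S < (4^-1)%:E)%E.

Local Notation noise := 'rV[R]_(n * K).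
Local Notation sds := (noise_sds K n s2).
Local Notation dot := (ndot s2).

Variables (h : nat -> R) (x : nat -> noise).
Hypothesis inputsE : forall i th z, (i < n)%N ->
  nth 0 (inputs K (acoef S) (bcoef S) th z n) i = h i * th + lin (x i) z.
Hypothesis unoise_x : forall i j, (1 <= j <= K)%N -> forall i', (i <= i' < n)%N ->
  dot (unoise R K n j i') (x i) = 0.

Let v := (\sum_(m < M) theta S m ^+ 2) / M%:R.

Let v_ge0 : 0 <= v.
Proof. by rewrite divr_ge0// sumr_ge0// => m _; rewrite sqr_ge0. Qed.

Let MR : 0 < M%:R :> R. Proof. by rewrite ltr0n. Qed.

(** The noise is centred, so the energy splits into a message part and a noise part. *)
Lemma power_bound : \sum_(i < n) (h i ^+ 2 * v + dot (x i) (x i)) <= n%:R * P.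
Proof.
have E m : ((\sum_(i < n) ((h i * theta S m) ^+ 2 + dot (x i) (x i)))%:E <=
    gexp sds (fun z => (\sum_(i < n) (nth 0 (sch_inputs K S m z) i) ^+ 2)%:E))%E.
  rewrite (eq_gexp (g := fun z =>
     \sum_(i < n) ((h i * theta S m + ev (coef (x i)) z) ^+ 2)%:E)%E); last first.
    move=> z; rewrite size_sds => sz; rewrite -sumEFin; apply: eq_bigr => i _.
    by rewrite /sch_inputs inputsE// evE.
  rewrite (@gexp_sum R sds n (fun i z => ((h i * theta S m + ev (coef (x i)) z) ^+ 2)%:E)).
  - rewrite -sumEFin; apply: lee_sum => i _.
    apply: le_trans (gexp_affine_sqr_ge _ _ (sds_gt0 n s2_gt0)).
    rewrite lee_fin lerD2l size_sds le_eqVlt; apply/orP; left; apply/eqP.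
    by apply: eq_bigr => j _; rewrite coefE -expr2.
  - by move=> i z; rewrite lee_fin sqr_ge0.
  - by move=> i; exact: seq_measurable_affine_sqr.
have : (((M%:R)^-1 * \sum_(m < M) \sum_(i < n) ((h i * theta S m) ^+ 2 + dot (x i) (x i)))%:E
    <= (n%:R * P)%:E)%E.
  apply: le_trans energy; rewrite /sch_energy EFinM; apply: lee_wpmul2l.
    by rewrite lee_fin invr_ge0 ler0n.
  by rewrite -sumEFin; apply: lee_sum => m _; exact: E.
rewrite lee_fin; apply: le_trans; rewrite exchange_big/= mulr_sumr.
apply: ler_sum => i _; rewrite big_split/= sumr_const card_ord mulrDr.
rewrite -(mulr_natl (dot (x i) (x i)) M) mulKf ?gt_eqF// lerD2r le_eqVlt; apply/orP; left; apply/eqP.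
rewrite /v mulrA mulr_sumr mulr_suml mulr_sumr; apply: eq_bigr => m _.
by rewrite exprMn; ring.
Qed.

Lemma sch_outputE k m z : (1 <= k <= K)%N -> size z = (n * K)%N ->
  sch_output K S m z k =
  output n (fun i => coef (obs x (unoise R K n) k i)) h (theta S m) z.
Proof.
move=> kK sz; apply: eq_from_tnth => i; rewrite !tnth_mktuple evE// linD.
by rewrite /sch_inputs inputsE// lin_unoise// addrA.
Qed.

Lemma measurable_any_error m :
  seq_measurable (n * K) (fun z =>
    (if [exists k : 'I_K, dec S k.+1 (sch_output K S m z k.+1) != m] then 1 else 0)%:E).
Proof.
pose A (k : 'I_K) := [set t : (n * K).-tuple R | dec S k.+1 (sch_output K S m t k.+1) != m].
have mA (k : 'I_K) : measurable (A k).
  have kK : (1 <= k.+1 <= K)%N by rewrite ltn_ord.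
  have mf : seq_measurable (n * K) (fun z =>
      ((dec S k.+1 (output n (fun i => coef (obs x (unoise R K n) k.+1 i)) h
         (theta S m) z) != m)%:R)%:E).
    apply: (@seq_measurable_dec R n _ h (dec S k.+1) (mdec kK) (predC1 m)).
    by exists m; right.
  have := mf measurableT _ (emeasurable_set1 1%:E); rewrite setTI.
  congr measurable; apply/seteqP; split => t; rewrite /A /= sch_outputE ?size_tuple//.
    by case: (_ != _) => //= -[] /eqP; rewrite eq_sym oner_eq0.
  by move=> ->.
rewrite /seq_measurable (_ : (fun _ => _) = EFin \o \1_(\bigcup_(k in [set: 'I_K]) A k)).
  apply/measurable_EFinP; apply: measurable_indic.
  by apply: fin_bigcup_measurable => // k _; exact: mA.
apply/funext => t /=; rewrite indicE; congr EFin.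
case: ifPn => [/existsP[k kA]|/existsPn kA].
  by rewrite mem_set//; exists k.
by rewrite memNset// => -[k _]; rewrite /A /= (negbTE (kA k)).
Qed.

Lemma output_error k : (1 <= k <= K)%N ->
  (\sum_(m < M) gexp sds (fun z =>
     ((dec S k (output n (fun i => coef (obs x (unoise R K n) k i)) h (theta S m) z) != m)%:R)%:E)
   <= (M%:R / 4)%:E)%E.
Proof.
move=> kK.
have M4 : ((M%:R)^-1%:E * \sum_(m < M) gexp sds (fun z =>
   ((dec S k (output n (fun i => coef (obs x (unoise R K n) k i)) h (theta S m) z) != m)%:R)%:E)
   <= (4^-1)%:E)%E.
  apply: le_trans (ltW perr); apply: lee_wpmul2l.
    by rewrite lee_fin invr_ge0 ler0n.
  apply: lee_sum => m _; apply: le_gexp.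
  - by move=> z; rewrite lee_fin.
  - move=> z; rewrite size_sds => sz; rewrite lee_fin -sch_outputE//.
    case: ifP => [_|/negbT]; first by case: (_ != _).
    rewrite negb_exists => /forallP/(_ (Ordinal (_ : k.-1 < K)%N)).
    have kk : (k.-1 < K)%N by lia.
    move=> /(_ kk)/=; rewrite prednK; last by lia.
    by rewrite negbK => /eqP->; rewrite eqxx.
  - have mk := mdec kK.
    apply: (@seq_measurable_dec R n _ h (dec S k) mk (predC1 (nat_of_ord m))).
    by exists (nat_of_ord m); right.
  - by rewrite size_sds; exact: measurable_any_error.
have Minv : 0 < (M%:R)^-1 :> R by rewrite invr_gt0.
rewrite -(lee_pmul2l _ (_ : 0 < ((M%:R)^-1)%:E)%E) ?lte_fin//.
by rewrite -EFinM mulKf ?gt_eqF.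
Qed.

Local Notation y := (obs x (unoise R K n)).
Local Notation rho k j := (cvar dot (others x (unoise R K n) k j) (y k j)).

Let e_x m i j : (1 <= m <= K)%N -> (j <= i < n)%N ->
  dot (unoise R K n m i) (x j) = 0.
Proof. by move=> mK ji; exact: unoise_x. Qed.

Let e_e := @ndot_unoise R K n s2 s2_gt0.
Let dC := @ndotC R K n s2.
Let dD := @ndotDl R K n s2.
Let dZ := @ndotZl R K n s2.
Let d0 := @ndot_ge0 R K n s2.
Let dE := @ndot_eq0 R K n s2 s2_gt0.

(* [h] is a combination of the dual basis of the outputs of receiver [k], so a
   small decoding error forces one output to be nearly determined by the others. *)
Lemma exists_predictable k : (1 <= k <= K)%N -> exists j : 'I_n,
  M%:R ^+ 2 * rho k j <=
  16 * expR 1 ^+ 2 * (34 * P + 2 * s2 k) * n%:R ^+ 2.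
Proof.
move=> kK; have sk := s2_gt0 kK.
have rho_gt0 (j : 'I_n) : 0 < rho k j.
  exact: (others_gt0 dC dD dZ d0 dE s2_gt0 e_x e_e).
have [w [yw ww]] := @dual_basis _ _ _ dC dD dZ d0 dE n (fun i => y k i)
  (fun i => h i) (fun j => rho k j) (fun j => erefl) rho_gt0.
(* [w] is dual for the covariance form, whereas a shift acts on plain coordinates; the variances
   convert one into the other. *)
pose c j := sds`_j ^+ 2 * coef w j.
have W2E : \sum_(j < size sds) c j ^+ 2 / sds`_j ^+ 2 = dot w w.
  rewrite size_sds; apply: eq_bigr => j _; rewrite /c coefE.
  by field; move: (sds_sqr_gt0 s2_gt0 (ltn_ord j)); rewrite exprn_even_gt0.
have yc i : (i < n)%N -> \sum_(j < size sds) coef (y k i) j * c j = h i.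
  move=> i_n; rewrite -(yw (Ordinal i_n)) size_sds; apply: eq_bigr => j _.
  by rewrite /c !coefE; ring.
have th_v : \sum_(m < M) theta S m ^+ 2 <= M%:R * v.
  by rewrite /v mulrC divfK// gt_eqF.
have := decoding_bound (sds_gt0 n s2_gt0) (mdec kK) yc v_ge0 th_v (output_error kK).
rewrite W2E => MW.
pose j := [arg min_(j < Ordinal n_gt0) rho k j]%O.
have jmin (i : 'I_n) : rho k j <= rho k i.
  by rewrite /j; case: arg_minP => // j0 _; apply.
exists j; set r := rho k j in jmin *.
have r0 : 0 < r by exact: rho_gt0.
have nR : 0 < n%:R :> R by rewrite ltr0n.
have n1 : 1 <= n%:R :> R by rewrite ler1n.
have hv0 (i : 'I_n) : true -> 0 <= h i ^+ 2 * v by rewrite mulr_ge0 ?sqr_ge0.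
have xx0 (i : 'I_n) : true -> 0 <= dot (x i) (x i) by [].
have hvP : \sum_(i < n) h i ^+ 2 * v <= n%:R * P.
  apply: le_trans power_bound; rewrite big_split/= lerDl.
  exact: sumr_ge0.
have xP (i : 'I_n) : dot (x i) (x i) <= n%:R * P.
  apply: le_trans power_bound.
  apply: (@le_trans _ _ (\sum_(i < n) dot (x i) (x i))).
    by rewrite (bigD1 i)//= lerDl sumr_ge0.
  by rewrite big_split/= lerDr sumr_ge0.
have P0 : 0 <= P.
  by rewrite -(pmulr_rge0 _ nR); apply: le_trans (xP (Ordinal n_gt0)).
have vw : v * dot w w <= n%:R ^+ 2 * P / r.
  apply: (@le_trans _ _ (v * (n%:R * \sum_(i < n) h i ^+ 2 / rho k i))).
    exact: ler_wpM2l.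
  have -> : n%:R ^+ 2 * P / r = n%:R * (n%:R * P / r) by ring.
  rewrite mulrCA; apply: ler_wpM2l; first exact: ler0n.
  have rV : 0 <= r^-1 by rewrite invr_ge0 ltW.
  apply: le_trans (ler_wpM2r rV hvP).
  rewrite mulr_sumr mulr_suml; apply: ler_sum => i _.
  rewrite mulrA [v * _]mulrC; apply: ler_wpM2l; first by rewrite mulr_ge0 ?sqr_ge0.
  by rewrite lef_pV2 ?posrE.
(* Controls the term [+ 1] of [decoding_bound] once everything is multiplied by [r]. *)
have rP : r <= n%:R * P + s2 k.
  apply: (@le_trans _ _ (cvar dot [::] (y k j))).
    by apply: (cvar_subset dC dD dZ d0 dE).
  have xe : dot (x j) (unoise R K n k j) = 0.
    by rewrite dC e_x// leqnn ltn_ord.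
  rewrite /obs (cvar_addnoise dC dD dZ dE xe)//.
  by rewrite e_e// !eqxx lerD2r; exact: xP.
set q := Num.sqrt v * Num.sqrt (dot w w).
have q2 : q ^+ 2 = v * dot w w by rewrite exprMn !sqr_sqrtr.
have q0 : 0 <= q by rewrite mulr_ge0 ?sqrtr_ge0.
have e0 := expR_gt0 (1 : R).
have qr : q ^+ 2 * r <= n%:R ^+ 2 * P by rewrite q2 -ler_pdivlMr.
(* Uses [(4 q + 1)^2 <= 32 q^2 + 2]. Times [r], the first term gives [32 P] and the second
   [2 P + 2 s2 k], up to [n^2]; hence [34 P + 2 s2 k]. *)
have M2 : M%:R ^+ 2 <= (4 * expR 1) ^+ 2 * (32 * q ^+ 2 + 2) :> R.
  apply: (@le_trans _ _ ((4 * expR 1) ^+ 2 * (4 * q + 1) ^+ 2)).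
    rewrite -exprMn ler_sqr ?nnegrE ?ler0n//; last first.
      by rewrite !mulr_ge0 ?addr_ge0 ?mulr_ge0// ltW.
    by move: MW; rewrite -(mulrA 4 (Num.sqrt v)).
  rewrite ler_wpM2l ?sqr_ge0//; have := sqr_ge0 (4 * q - 1); lra.
apply: le_trans (ler_wpM2r (ltW r0) M2) _.
have -> : (4 * expR 1) ^+ 2 = 16 * expR 1 ^+ 2 :> R by ring.
rewrite -[leRHS]mulrA -[leLHS]mulrA; apply: ler_wpM2l.
  by rewrite mulr_ge0 ?sqr_ge0.
have nP : n%:R * P <= n%:R ^+ 2 * P by rewrite ler_wpM2r// expr2 ler_peMr.
have ns : s2 k <= n%:R ^+ 2 * s2 k.
  by apply: ler_peMl; [exact: ltW|exact: exprn_ege1].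
lra.
Qed.
End Scheme.

(** * The converse bound *)

Section Converse.
Local Open Scope classical_set_scope.
Variable R : realType.
Variables (K : nat) (s2 : nat -> R) (P : R) (alpha : nat -> R).
Hypothesis s2_gt0 : forall m, (1 <= m <= K)%N -> 0 < s2 m.
Hypotheses (K_gt0 : (0 < K)%N) (P_gt0 : 0 < P).
Hypothesis alphaP : alpha_star K s2 P alpha.

(** Power left after the shares of receivers 1 to [k]; these are the tangent points [p] of
    [chain_bound]. *)
Definition level k := (1 - \sum_(1 <= i < k.+1) alpha i) * P.

(** The exponential of [2 * rate1 s2 P alpha]. *)
Definition ratio := 1 + alpha 1%N * P / ((1 - alpha 1%N) * P + s2 1%N).

Lemma level0 : level 0 = P.
Proof. by rewrite /level big_geq// subr0 mul1r. Qed.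

Lemma levelK : level K = 0.
Proof. by case: alphaP => _ + _; rewrite /level => ->; rewrite subrr mul0r. Qed.

Lemma levelS k : level k = level k.+1 + alpha k.+1 * P.
Proof. by rewrite /level [in RHS]big_nat_recr//=; ring. Qed.

Lemma alphaP_gt0 k : (1 <= k <= K)%N -> 0 < alpha k * P.
Proof. by case: alphaP => a01 _ _ /a01/andP[a0 _]; rewrite mulr_gt0. Qed.

Lemma level_ge0 k : (k <= K)%N -> 0 <= level k.
Proof.
move=> kK; rewrite -(subKn kK); elim: (K - k)%N => [|d IH].
  by rewrite subn0 levelK.
have [dK|Kd] := ltnP d K; last by have -> : (K - d.+1 = K - d)%N by lia.
rewrite levelS -subSn// subSS addr_ge0// ltW// alphaP_gt0//; lia.
Qed.

Lemma Nk1 : Nk s2 1 = s2 1%N.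
Proof. by rewrite /Nk big_nat1 invrK. Qed.

Lemma level1 : level 1 = (1 - alpha 1%N) * P.
Proof. by rewrite /level big_nat1. Qed.

Lemma level_ratio k : (1 <= k <= K)%N ->
  level k.-1 + Nk s2 k = ratio * (level k + Nk s2 k).
Proof.
move=> kK; have Ngt q : (1 <= q <= K)%N -> 0 < level q + Nk s2 q.
  by move=> qK; rewrite ltr_wpDl ?(Nk_gt0 s2_gt0)// level_ge0//; lia.
have pos q : (1 <= q <= K)%N -> 0 < 1 + alpha q * P / (level q + Nk s2 q).
  by move=> qK; rewrite ltr_wpDr// ltW// divr_gt0 ?alphaP_gt0 ?Ngt.
have K1 : (1 <= 1 <= K)%N by rewrite K_gt0.
have rE : 1 + alpha k * P / (level k + Nk s2 k) = ratio.
  have [->|k1] := eqVneq k 1%N; first by rewrite level1 Nk1.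
  have k2 : (2 <= k <= K)%N by lia.
  case: alphaP => _ _ /(_ k k2); rewrite /rate1 -/ratio -/(level k).
  have h2 : 2^-1 != 0 :> R by rewrite invr_eq0.
  move=> /(mulfI h2) /ln_inj; apply; rewrite posrE; first exact: pos.
  by have := pos _ K1; rewrite level1 Nk1.
rewrite -rE mulrDl mul1r divfK ?gt_eqF ?Ngt//.
by case: k kK {rE} => // k kK; rewrite /= levelS addrAC.
Qed.

Lemma Nk_decr k : (1 <= k < K)%N -> Nk s2 k.+1 <= Nk s2 k.
Proof.
move=> kK; rewrite -lef_pV2 ?posrE ?(Nk_gt0 s2_gt0)//; try lia.
rewrite /Nk !invrK [leRHS]big_nat_recr//= lerDl invr_ge0 ltW// s2_gt0//; lia.
Qed.

(** Summing the constants of [exists_predictable] over receivers, after division by [s2 k], gives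
    one constant valid for all of them. *)
Definition Cbound : R :=
  \sum_(1 <= k < K.+1) 16 * expR 1 ^+ 2 * (34 * P + 2 * s2 k) / s2 k.

Let term_ge0 k : (1 <= k <= K)%N ->
  0 <= 16 * expR 1 ^+ 2 * (34 * P + 2 * s2 k) / s2 k.
Proof.
move=> kK; have s0 := s2_gt0 kK; apply: divr_ge0; last exact: ltW.
apply: mulr_ge0; first by rewrite mulr_ge0 ?sqr_ge0.
by apply: addr_ge0; apply: mulr_ge0 => //; exact: ltW.
Qed.

Lemma Cbound_ge k : (1 <= k <= K)%N ->
  16 * expR 1 ^+ 2 * (34 * P + 2 * s2 k) / s2 k <= Cbound.
Proof.
move=> kK; rewrite /Cbound (bigD1_seq k) ?iota_uniq ?mem_index_iota ?ltnS//=.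
rewrite lerDl big_seq_cond sumr_ge0// => i /andP[+ _].
by rewrite mem_index_iota ltnS; exact: term_ge0.
Qed.

Lemma Cbound_gt0 : 0 < Cbound.
Proof.
apply: lt_le_trans (Cbound_ge (k := 1) _); last by rewrite K_gt0.
have s0 := s2_gt0 (m := 1%N) K_gt0.
by rewrite divr_gt0// mulr_gt0 ?addr_gt0 ?mulr_gt0 ?exprn_gt0 ?expR_gt0.
Qed.

(** An application of [chain_bound] with [D = M^2 / (Cbound * n^2)]. *)
Lemma message_bound (n M : nat) (S : lin_scheme R n) : (0 < n)%N -> (0 < M)%N ->
  dec_measurable K S -> (sch_energy K s2 M S <= (n%:R * P)%:E)%E ->
  (sch_perr K s2 M S < (4^-1)%:E)%E ->
  M%:R ^+ 2 <= Cbound * n%:R ^+ 2 * ratio ^+ n.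
Proof.
move=> n0 M0 mdec en er.
have [h [x [unoise_x inputsE]]] := @inputs_linear R K n s2 (acoef S) (bcoef S).
pose V k i := cvar (ndot s2) (past x (unoise R K n) k i) (x i).
have CN : 0 < Cbound * n%:R ^+ 2 by rewrite mulr_gt0 ?Cbound_gt0// exprn_gt0// ltr0n.
rewrite mulrC -ler_pdivrMr//.
have d0 := @ndot_ge0 R K n s2.
have dE := @ndot_eq0 R K n s2 s2_gt0.
have V_ge0 k i : 0 <= V k i by exact: cvar_ge0.
apply: (@chain_bound R K n P ratio _ (Nk s2) level V) => //.
- have N1 : (1 <= 1 <= K)%N by rewrite K_gt0.
  rewrite ltr_wpDr// ltW// divr_gt0 ?alphaP_gt0// -level1 -Nk1.
  by rewrite ltr_wpDl ?level_ge0 ?(Nk_gt0 s2_gt0).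
- by move=> k; exact: Nk_gt0.
- exact: Nk_decr.
- exact: level_ge0.
- exact: level0.
- exact: levelK.
- exact: level_ratio.
- apply: le_trans (power_bound s2_gt0 M0 en inputsE); apply: ler_sum => i _.
  have -> : V 0%N i = ndot s2 (x i) (x i).
    by rewrite /V (_ : past _ _ _ _ = [::])//; elim: (nat_of_ord i).
  by rewrite lerDr mulr_ge0 ?sqr_ge0// divr_ge0// sumr_ge0// => m _; rewrite sqr_ge0.
(* The predictable output bounds the residual in [past_chain] by a multiple of [n^2 / M^2];
   multiplication by [Nk^n] then turns [1 + tau * V] into [V + Nk]. *)
move=> [//|k] kK; have sk := s2_gt0 kK.
have [j jP] := exists_predictable s2_gt0 n0 M0 mdec en er inputsE unoise_x kK.
have e_x m i l : (1 <= m <= K)%N -> (l <= i < n)%N -> ndot s2 (unoise R K n m i) (x l) = 0.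
  by move=> mK li; exact: unoise_x.
have := past_chain (@ndotC R K n s2) (@ndotDl R K n s2) (@ndotZl R K n s2) d0 dE
  s2_gt0 e_x (@ndot_unoise R K n s2 s2_gt0) j kK.
have Nk0 : 0 < Nk s2 k.+1 by exact: (Nk_gt0 s2_gt0).
have prodE q : \prod_(i < n) (V q i + Nk s2 k.+1) =
    Nk s2 k.+1 ^+ n * \prod_(i < n) (1 + tau s2 k.+1 * V q i).
  have -> : Nk s2 k.+1 ^+ n = \prod_(i < n) Nk s2 k.+1 by rewrite prodr_const card_ord.
  rewrite -big_split/=; apply: eq_bigr => i _.
  have -> : tau s2 k.+1 = (Nk s2 k.+1)^-1 by rewrite /Nk invrK.
  by field; rewrite gt_eqF.
rewrite !prodE /= => ch.
rewrite mulrCA ler_pM2l ?exprn_gt0// mulrAC ler_pdivrMr//.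
set A := \prod_(i < n) _ in ch *; set B := \prod_(i < n) _ in ch *.
have B0 : 0 <= B.
  apply: prodr_ge0 => i _; rewrite addr_ge0// mulr_ge0//.
  - exact: (tau_ge0 s2_gt0).
  - exact: V_ge0.
rewrite -(ler_pM2l sk) mulrCA.
apply: le_trans (ler_wpM2l (sqr_ge0 _) ch) _.
rewrite mulrA; apply: le_trans (ler_wpM2r B0 jP) _.
have := Cbound_ge kK; rewrite ler_pdivrMr// => H.
have -> : s2 k.+1 * (B * (Cbound * n%:R ^+ 2)) = Cbound * s2 k.+1 * n%:R ^+ 2 * B.
  by ring.
by apply: ler_wpM2r => //; apply: ler_wpM2r => //; exact: sqr_ge0.
Qed.

Lemma achievable_le r : lin_achievable K s2 P r -> r <= rate1 s2 P alpha.
Proof.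
have arith (q t c : R) : t * (24 * c) < q -> 1 + q / 6 <= 4 * (c * t) -> False by lra.
move=> [r0 ach]; rewrite leNgt; apply/negP => rate_lt.
have ratio_gt0 : 0 < ratio.
  have := level_ratio (k := 1%N) K_gt0; rewrite level0.
  have N0 := Nk_gt0 s2_gt0 (k := 1%N) K_gt0; have l0 := level_ge0 K_gt0.
  have : 0 < level 1 + Nk s2 1 by rewrite ltr_wpDl.
  by move=> H E; rewrite -(pmulr_lgt0 _ H) -E addr_gt0.
pose d := 2 * r - ln ratio.
have d0 : 0 < d by move: rate_lt; rewrite /rate1 -/ratio /d; lra.
have [N NP] := ach 4^-1 ltac:(lra).
(* The number of messages satisfies [exp (n r) < 2 M], so [message_bound] yields
   [exp (n d) <= 4 * Cbound * n^2]. The cubic term [(n d)^3 / 6] of the exponential refutes this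
   once [n d^3 > 24 * Cbound]. *)
pose n := maxn N (maxn 1 (Num.truncn (24 * Cbound / d ^+ 3)).+1).
have nN : (N <= n)%N by rewrite leq_maxl.
have n0 : (0 < n)%N by rewrite /n; lia.
have nR : 0 < n%:R :> R by rewrite ltr0n.
have nbig : 24 * Cbound / d ^+ 3 < n%:R.
  apply: lt_le_trans (truncnS_gt _) _; by rewrite ler_nat !leq_max leqnn !orbT.
have [S [mdec en er]] := NP n nN.
set M := num_messages n r in en er.
have e1 : 1 <= expR (n%:R * r) by rewrite -expR0 ler_expR mulr_ge0// ltW.
have M0 : (0 < M)%N by rewrite /M /num_messages truncn_gt0.
have MB := message_bound n0 M0 mdec en er.
have M1 : 1 <= M%:R :> R by rewrite ler1n.
have eM : expR (n%:R * r) < 2 * M%:R.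
  have := truncnS_gt (expR (n%:R * r)); rewrite -natr1.
  rewrite -[(Num.truncn _)%:R]/(M%:R : R) => H; apply: lt_le_trans H _.
  by rewrite mulr_natl mulr2n lerD2l.
have e2 : expR (n%:R * r) ^+ 2 <= 4 * M%:R ^+ 2.
  have -> : 4 * M%:R ^+ 2 = (2 * M%:R) ^+ 2 :> R by ring.
  by rewrite ler_sqr ?nnegrE ?expR_ge0 ?mulr_ge0// ltW.
have e3 : expR (n%:R * d) * ratio ^+ n = expR (n%:R * r) ^+ 2.
  have rE : ratio = expR (ln ratio) by rewrite lnK ?posrE.
  rewrite {1}rE -!expRM_natl -expRD; congr expR.
  by rewrite /d; ring.
have rn : 0 < ratio ^+ n by rewrite exprn_gt0.
have e4 : expR (n%:R * d) <= 4 * (Cbound * n%:R ^+ 2).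
  rewrite -(ler_pM2r rn) e3; apply: le_trans e2 _.
  by rewrite -mulrA ler_wpM2l.
have nd : 0 <= n%:R * d by apply: mulr_ge0; exact: ltW.
have := expR_ge1Dxn 2 nd; rewrite exprMn => e5.
have d3 : 0 < d ^+ 3 by rewrite exprn_gt0.
move: nbig; rewrite ltr_pdivrMr// => nbig.
have n2 : 0 < n%:R ^+ 2 :> R by rewrite exprn_gt0.
have : n%:R ^+ 2 * (24 * Cbound) < n%:R ^+ 2 * (n%:R * d ^+ 3) by rewrite ltr_pM2l.
have -> : n%:R ^+ 2 * (n%:R * d ^+ 3) = n%:R ^+ 3 * d ^+ 3 by ring.
have f3 : (2.+1`!)%:R = 6 :> R by [].
rewrite f3 in e5 => lt24; exact: arith lt24 (le_trans e5 e4).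
Qed.

End Converse.

Theorem theorem1 (R : realType) (K : nat) (P : R) (s2 : nat -> R) :
  (2 <= K)%N -> 0 < P ->
  (forall k, (1 <= k < K)%N -> s2 k.+1 <= s2 k) -> 0 < s2 K ->
  (exists alpha : nat -> R, alpha_star K s2 P alpha) /\
  (forall alpha : nat -> R, alpha_star K s2 P alpha ->
     (C_Lin K s2 P <= (rate1 s2 P alpha)%:E)%E).
Proof.
move=> K2 P0 s2_decr sK.
have s2_gt0 k : (1 <= k <= K)%N -> 0 < s2 k.
  move=> /andP[k1 kK]; rewrite -(subKn kK).
  have : (K - k < K)%N by lia.
  elim: (K - k)%N => [|d IH] dK; first by rewrite subn0.
  apply: lt_le_trans (IH (ltnW dK)) _.
  have -> : (K - d = (K - d.+1).+1)%N by lia.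
  by apply: s2_decr; lia.
split; first exact: exists_alpha_star.
move=> alpha alphaP; apply: ub_ereal_sup => _ [r ach <-].
by rewrite lee_fin; apply: (achievable_le s2_gt0 _ P0 alphaP ach); lia.
Qed.
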